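(* Suppose $0\le i\le n$, $a\in\mathbb{N}$ and $\ell\in\mathbb{N}_+$. Set $u:=\frac{n-1}2-i-\ell-a$. Then, as differential operators from forms on $\mathbb{R}^n$ to forms on $\mathbb{R}^{n-1}$, (1) $\displaystyle\mathcal{T}'^{(i-1)}_{2\ell}\circ\mathcal{D}^{i\to i-1}_{u,a}=-\Big(\frac{n+1}2-i+\ell\Big)K_{\ell,a}\,\mathcal{D}^{i\to i-1}_{u,a+2\ell}$ if $i\neq0$; (2) $\displaystyle\mathcal{T}'^{(i)}_{2\ell}\circ\mathcal{D}^{i\to i}_{u,a}=-\Big(\frac{n-1}2-i-\ell\Big)K_{\ell,a}\,\mathcal{D}^{i\to i}_{u,a+2\ell}$ if $i\neq n$.
   Context: $n\ge2$; $\mathbb{N}=\{0,1,2,\dots\}$, $\mathbb{N}_+=\{1,2,\dots\}$; $\mathcal{E}^i$: smooth complex-valued $i$-forms. $K_{\ell,a}=\prod_{k=1}^{\ell}\big([\frac a2]+k\big)$. Branson's operator on $\mathcal{E}^j(\mathbb{R}^{n-1})$, $0\le j\le n-1$: $$\mathcal{T}'^{(j)}_{2\ell}=\Big(\big(\tfrac{n-1}2-j-\ell\big)d_{\mathbb{R}^{n-1}}d^*_{\mathbb{R}^{n-1}}+\big(\tfrac{n-1}2-j+\ell\big)d^*_{\mathbb{R}^{n-1}}d_{\mathbb{R}^{n-1}}\Big)\Delta_{\mathbb{R}^{n-1}}^{\ell-1},$$ where $d^*$ is the formal adjoint of $d$ for the flat metric and $\Delta=-(dd^*+d^*d)$, i.e.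 $\sum_{j=1}^{n-1}\partial^2/\partial x_j^2$ coefficientwise. $\mathbb{R}^{n-1}=\{x_n=0\}\subset\mathbb{R}^n$, $\mathrm{Rest}_{x_n=0}$ is pull-back of forms, $\iota_{\partial/\partial x_n}$ interior multiplication. For $\mu\in\mathbb{C}$, $b\in\mathbb{N}$, $$\mathcal{D}^\mu_b=\sum_{k=0}^{[b/2]}\frac{2^{b-2k}}{k!(b-2k)!}\Big(\prod_{m=[(b+1)/2]}^{b-k-1}(\mu+m)\Big)\Delta_{\mathbb{R}^{n-1}}^k\Big(\frac{\partial}{\partial x_n}\Big)^{b-2k}$$ (empty product $=1$), acting coefficientwise on forms on $\mathbb{R}^n$, and $\mathcal{D}^\mu_b=0$ for $b<0$. $\gamma(\mu,a)=1$ for $a$ odd, $=\mu+\frac a2$ for $a$ even. With $\mu:=u+i-\frac{n-1}2$, the operators $\mathcal{D}^{i\to i-1}_{u,a}:\mathcal{E}^i(\mathbb{R}^n)\to\mathcal{E}^{i-1}(\mathbb{R}^{n-1})$ ($1\le i\le n$) and $\mathcal{D}^{i\to i}_{u,a}:\mathcal{E}^i(\mathbb{R}^n)\to\mathcal{E}^{i}(\mathbb{R}^{n-1})$ ($0\le i\le n-1$) are $$\mathcal{D}^{i\to i-1}_{u,a}=\mathrm{Rest}_{x_n=0}\circ\Big(-\mathcal{D}^{\mu+1}_{a-2}dd^*\iota_{\frac{\partial}{\partial x_n}}-\gamma(\mu,a)\mathcal{D}^{\mu+1}_{a-1}d^*+\tfrac12(u+2i-n)\mathcal{D}^\mu_a\iota_{\frac{\partial}{\partial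 x_n}}\Big),$$ $$\mathcal{D}^{i\to i}_{u,a}=\mathrm{Rest}_{x_n=0}\circ\Big(\mathcal{D}^{\mu+1}_{a-2}dd^*-\gamma(\mu-\tfrac12,a)\mathcal{D}^{\mu}_{a-1}d\,\iota_{\frac{\partial}{\partial x_n}}+\tfrac12(u+a)\mathcal{D}^\mu_a\Big),$$ with $d,d^*$ on $\mathbb{R}^n$. *)

(* Defs.v *)
From HB Require Import structures.
From mathcomp Require Import all_boot all_order all_algebra.
From mathcomp Require Import all_classical all_reals all_analysis.
From mathcomp Require Import complex ring.

Set Implicit Arguments.
Unset Strict Implicit.
Unset Printing Implicit Defensive.
Import Order.TTheory GRing.Theory Num.Theory.
Import numFieldNormedType.Exports.
Local Open Scope ring_scope.
Local Open Scope complex_scope.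

(* The value [w x [:: v_1; ...; v_i]] is that of the form [w] at the point [x]
   on the tangent vectors v_1, ..., v_i.  The arguments come as a list so that
   all degrees live in one type: a form of degree i vanishes on the lists whose
   length is not i (see [is_form]), and a contraction that would lower the
   degree below 0 gives 0.  The codomain is written [R[i]^o] to have the
   pointwise complex scaling [c *: w]. *)
Definition cochain (R : realType) (n : nat) :=
  'rV[R]_n -> seq 'rV[R]_n -> R[i]^o.

Section Forms.
Variables (R : realType) (n : nat).
Implicit Types (f : 'rV[R]_n -> R[i]) (w : cochain R n) (v x : 'rV[R]_n).

Definition basis_vec (j : 'I_n) : 'rV[R]_n := delta_mx 0 j.

Definition Cderive v f : 'rV[R]_n -> R[i] := fun x =>
  'D_v (fun y => complex.Re (f y)) x +i* 'D_v (fun y => complex.Im (f y)) x.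

Definition Cdifferentiable f x :=
  differentiable (fun y => complex.Re (f y)) x /\
  differentiable (fun y => complex.Im (f y)) x.

Definition smooth f :=
  forall (vs : seq 'rV[R]_n) x, Cdifferentiable (foldr Cderive f vs) x.

(* w is an element of E^i(R^n). *)
Definition is_form (i : nat) w : Prop :=
  [/\ forall s, smooth (w ^~ s),
      forall x s, size s != i -> w x s = 0,
      forall x s1 s2 (c : R) v1 v2,
        w x (s1 ++ (c *: v1 + v2) :: s2)
        = c%:C * w x (s1 ++ v1 :: s2) + w x (s1 ++ v2 :: s2)
    & forall x s, ~~ uniq s -> w x s = 0].

(* Derivative of the coefficients with respect to the flat connection. *)
Definition form_derive v w : cochain R n :=
  fun x s => Cderive v (w ^~ s) x.

Definition interior v w : cochain R n := fun x s => w x (v :: s).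

(* (dw)(v_0, ..., v_i) = \sum_k (-1)^k v_k(w(v_0, .., v_(k-1), v_(k+1), .., v_i))
   for constant vector fields. *)
Definition ext_d w : cochain R n := fun x s =>
  \sum_(k < size s)
    (-1) ^+ k * form_derive (nth 0 s k) w x (take k s ++ drop k.+1 s).

(* Formal adjoint of [ext_d]: as d = \sum_j e^j /\ (d/dx_j) and contraction with
   e_j is the adjoint of e^j /\ for the flat metric, integration by parts gives
   d^* = - \sum_j i_(e_j) (d/dx_j); see [codiff_formal_adjoint]. *)
Definition codiff w : cochain R n :=
  - \sum_(j < n) interior (basis_vec j) (form_derive (basis_vec j) w).

Definition hodge_laplacian w : cochain R n :=
  - (ext_d (codiff w) + codiff (ext_d w)).

(* Pointwise Hermitian product of two i-forms; each i-element set of indices is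
   counted i! times in the sum. *)
Definition form_dot (i : nat) (w1 w2 : cochain R n) x : R[i] :=
  (i`!%:R)^-1 * \sum_(t : i.-tuple 'I_n)
    w1 x (map basis_vec t) * (w2 x (map basis_vec t))^*.

Lemma smoothW f x : smooth f -> Cdifferentiable f x.
Proof. by move=> /(_ [::] x). Qed.

Lemma Cderive_mul_conj f g v x : Cdifferentiable f x -> Cdifferentiable g x ->
  Cderive v (fun y => f y * (g y)^*) x
  = Cderive v f x * (g x)^* + f x * (Cderive v g x)^*.
Proof.
move=> [/(@diff_derivable _ _ _ _ _ v) dfr /(@diff_derivable _ _ _ _ _ v) dfi].
move=> [/(@diff_derivable _ _ _ _ _ v) dgr /(@diff_derivable _ _ _ _ _ v) dgi].
rewrite /Cderive.
have -> : (fun y => complex.Re (f y * (g y)^*)) =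
    (fun y => complex.Re (f y)) * (fun y => complex.Re (g y))
    + (fun y => complex.Im (f y)) * (fun y => complex.Im (g y)).
  by apply/funext => y /=; rewrite !fctE; case: (f y) (g y) => ? ? [? ?] /=;
     rewrite mulrN opprK.
have -> : (fun y => complex.Im (f y * (g y)^*)) =
    (fun y => complex.Im (f y)) * (fun y => complex.Re (g y))
    - (fun y => complex.Re (f y)) * (fun y => complex.Im (g y)).
  by apply/funext => y /=; rewrite !fctE; case: (f y) (g y) => ? ? [? ?] /=;
     rewrite mulrN addrC.
rewrite (deriveD (derivableM dfr dgr) (derivableM dfi dgi)).
rewrite (deriveB (derivableM dfi dgr) (derivableM dfr dgi)).
rewrite (deriveM dfr dgr) (deriveM dfi dgi) (deriveM dfi dgr) (deriveM dfr dgi).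
rewrite /GRing.scale /=.
by case: (f x) (g x) => ? ? [? ?] /=; simpc; congr (_ +i* _); ring.
Qed.

Lemma CdifferentiableM_conj f g x : Cdifferentiable f x -> Cdifferentiable g x ->
  Cdifferentiable (fun y => f y * (g y)^*) x.
Proof.
move=> [fr fi] [gr gi]; split.
- have -> : (fun y => complex.Re (f y * (g y)^*)) =
    (fun y => complex.Re (f y)) * (fun y => complex.Re (g y))
    + (fun y => complex.Im (f y)) * (fun y => complex.Im (g y)).
    by apply/funext => y /=; rewrite !fctE; case: (f y) (g y) => ? ? [? ?] /=;
       rewrite mulrN opprK.
  by apply: differentiableD; exact: differentiableM.
- have -> : (fun y => complex.Im (f y * (g y)^*)) =
    (fun y => complex.Im (f y)) * (fun y => complex.Re (g y))
    - (fun y => complex.Re (f y)) * (fun y => complex.Im (g y)).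
    by apply/funext => y /=; rewrite !fctE; case: (f y) (g y) => ? ? [? ?] /=;
       rewrite mulrN addrC.
  by apply: differentiableB; exact: differentiableM.
Qed.

Lemma Cderive_sum (I : finType) (F : I -> 'rV[R]_n -> R[i]) (c : R) v x :
  (forall t, Cdifferentiable (F t) x) ->
  Cderive v (fun y => c%:C * \sum_t F t y) x = c%:C * \sum_t Cderive v (F t) x.
Proof.
move=> dF.
pose Fr (t : I) := fun y => complex.Re (F t y).
pose Fi (t : I) := fun y => complex.Im (F t y).
have dFr t : differentiable (Fr t) x by case: (dF t).
have dFi t : differentiable (Fi t) x by case: (dF t).
have ReS y : complex.Re (\sum_t F t y) = \sum_t Fr t y.
  exact: (big_morph (@complex.Re R) (fun a b => raddfD _ a b)).
have ImS y : complex.Im (\sum_t F t y) = \sum_t Fi t y.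
  exact: (big_morph (@complex.Im R) (fun a b => raddfD _ a b)).
have dS (G : I -> 'rV[R]_n -> R) : (forall t, differentiable (G t) x) ->
    'D_v (fun y => c * \sum_t G t y) x = c * \sum_t 'D_v (G t) x.
  move=> dG.
  have -> : (fun y => c * \sum_t G t y) = c \*: (fun y => \sum_t G t y).
    by apply/funext => y.
  have Gs : (fun y => \sum_t G t y) = \sum_t G t.
    by apply/funext => y; rewrite fct_sumE.
  suff [d0 e] : differentiable (\sum_t G t) x /\
      'D_v (\sum_t G t) x = \sum_t 'D_v (G t) x.
    by rewrite Gs deriveZ ?e //; exact: diff_derivable.
  elim/big_rec2: _ => [|t y1 y2 _ [d1 e1]].
    split; first exact: differentiable_cst.
    exact: derive_cst.
  by split; [exact: differentiableD|rewrite deriveD ?e1 //; exact: diff_derivable].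
rewrite /Cderive.
have -> : (fun y => complex.Re (c%:C * \sum_t F t y)) =
    (fun y => c * \sum_t Fr t y).
  by apply/funext => y; rewrite -ReS; case: (\sum_t F t y) => ? ? /=; rewrite mul0r subr0.
have -> : (fun y => complex.Im (c%:C * \sum_t F t y)) =
    (fun y => c * \sum_t Fi t y).
  by apply/funext => y; rewrite -ImS; case: (\sum_t F t y) => ? ? /=; rewrite mul0r addr0.
rewrite !dS //.
have -> : \sum_t Cderive v (F t) x =
    (\sum_t 'D_v (Fr t) x) +i* (\sum_t 'D_v (Fi t) x).
  by elim/big_rec3: _ => // t a b z _ ->; rewrite /Cderive; simpc.
by simpc.
Qed.

Lemma form_swap i w x s1 s2 v1 v2 : is_form i w ->
  w x (s1 ++ v1 :: v2 :: s2) = - w x (s1 ++ v2 :: v1 :: s2).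
Proof.
case=> _ _ lin alt.
have add t1 t2 a b : w x (t1 ++ (a + b) :: t2) =
    w x (t1 ++ a :: t2) + w x (t1 ++ b :: t2).
  by rewrite -[a in LHS]scale1r lin mul1r.
have alt2 a : w x (s1 ++ a :: a :: s2) = 0.
  by apply: alt; rewrite cat_uniq /= inE eqxx /= !andbF.
have add2 a b c : w x (s1 ++ a :: (b + c) :: s2) =
    w x (s1 ++ a :: b :: s2) + w x (s1 ++ a :: c :: s2).
  by rewrite -!(cat_rcons a) add.
have := alt2 (v1 + v2); rewrite add !add2 !alt2 add0r addr0 => /eqP.
by rewrite addr_eq0 => /eqP.
Qed.

Lemma form_move i w x s0 s1 s2 v : is_form i w ->
  w x (s0 ++ s1 ++ v :: s2) = (-1) ^+ size s1 * w x (s0 ++ v :: s1 ++ s2).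
Proof.
move=> fw; elim: s1 s0 => [|a s1 IH] s0 /=; first by rewrite mul1r.
have := IH (rcons s0 a); rewrite !cat_rcons => ->.
by rewrite (form_swap _ _ _ _ _ fw) mulrN exprS mulN1r mulNr.
Qed.

Lemma sum_tuple_insert (V : zmodType) (i : nat) (F : seq 'I_n -> V) k :
  (k <= i)%N ->
  \sum_(t : i.+1.-tuple 'I_n) F t =
  \sum_(j < n) \sum_(s : i.-tuple 'I_n) F (take k s ++ j :: drop k s).
Proof.
move=> ki; rewrite pair_big /=.
have sz (p : 'I_n * i.-tuple 'I_n) :
    size (take k p.2 ++ p.1 :: drop k p.2) == i.+1.
  by rewrite size_cat /= addnS -size_cat cat_take_drop size_tuple.
have sz' (t : i.+1.-tuple 'I_n) : size (take k t ++ drop k.+1 t) == i.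
    rewrite size_cat size_drop size_take size_tuple ltnS ki subSS.
    by rewrite subnKC.
rewrite (reindex (fun p => Tuple (sz p))) //=.
exists (fun t => (tnth t (inord k), Tuple (sz' t))) => [[j s]|t] _ /=.
  have st : size (take k s) = k by rewrite size_takel ?size_tuple.
  congr pair.
    by rewrite (tnth_nth j) /= inordK // nth_cat st ltnn subnn.
  apply/val_inj; rewrite /= take_cat st ltnn subnn take0 cats0.
  by rewrite drop_cat st ltnNge leqnSn /= subSnn /= drop0 cat_take_drop.
apply/val_inj => /=.
have st : size (take k t) = k by rewrite size_takel ?size_tuple // ltnW.
rewrite take_cat st ltnn subnn take0 cats0 drop_cat st ltnn subnn drop0.
rewrite (tnth_nth (tnth t ord0)) inordK // -drop_nth ?size_tuple //.
by rewrite cat_take_drop.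
Qed.

(* <d w1, w2> - <w1, d^* w2> is the divergence of \sum_j <w1, i_(e_j) w2> e_j,
   so its integral over R^n is 0 when w1 or w2 has compact support. *)
Lemma codiff_formal_adjoint (i : nat) w1 w2 x :
  is_form i w1 -> is_form i.+1 w2 ->
  form_dot i.+1 (ext_d w1) w2 x - form_dot i w1 (codiff w2) x
  = \sum_(j < n) Cderive (basis_vec j)
      (fun y => form_dot i w1 (interior (basis_vec j) w2) y) x.
Proof.
move=> f1 f2; have [s1 _ _ _] := f1; have [s2 _ _ _] := f2.
pose e (s : seq 'I_n) := map basis_vec s.
pose A (j : 'I_n) (s : i.-tuple 'I_n) :=
  Cderive (basis_vec j) (w1 ^~ (e s)) x * (w2 x (basis_vec j :: e s))^*.
pose B (j : 'I_n) (s : i.-tuple 'I_n) :=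
  w1 x (e s) * (Cderive (basis_vec j) (w2 ^~ (basis_vec j :: e s)) x)^*.
have invC k : (k%:R : R[i])^-1 = (k%:R^-1 : R)%:C.
  by rewrite fmorphV rmorph_nat.
have D1 : form_dot i.+1 (ext_d w1) w2 x = (i`!%:R)^-1 * \sum_j \sum_s A j s.
  have Dk (k : 'I_i.+1) : \sum_(t : i.+1.-tuple 'I_n)
      (-1) ^+ k * form_derive (nth 0 (e t) k) w1 x
                    (take k (e t) ++ drop k.+1 (e t)) * (w2 x (e t))^*
      = \sum_j \sum_s A j s.
    have ki : (k <= i)%N by rewrite -ltnS.
    pose G (t : seq 'I_n) : R[i] :=
      (-1) ^+ k * form_derive (nth 0 (e t) k) w1 x
                    (take k (e t) ++ drop k.+1 (e t)) * (w2 x (e t))^*.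
    rewrite -/(G _) (sum_tuple_insert G ki).
    apply: eq_bigr => j _; apply: eq_bigr => s _; rewrite /G.
    have st : size (take k s) = k by rewrite size_takel ?size_tuple.
    have ek : nth 0 (e (take k s ++ j :: drop k s)) k = basis_vec j.
      by rewrite /e map_cat nth_cat size_map st ltnn subnn.
    have es : take k (e (take k s ++ j :: drop k s)) ++
              drop k.+1 (e (take k s ++ j :: drop k s)) = e s.
      rewrite /e -map_take -map_drop -map_cat take_cat st ltnn subnn take0.
      rewrite cats0 drop_cat st ltnNge leqnSn /= subSnn /= drop0.
      by rewrite cat_take_drop.
    have w2s : w2 x (e (take k s ++ j :: drop k s)) =
        (-1) ^+ k * w2 x (basis_vec j :: e s).
      have := form_move x [::] (map basis_vec (take k s))
                (map basis_vec (drop k s)) (basis_vec j) f2.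
      by rewrite /= size_map st -map_cat cat_take_drop /e map_cat.
    rewrite ek es w2s rmorphM /= rmorphXn /= rmorphN1 mulrACA -exprMn mulrNN.
    by rewrite mulr1 expr1n mul1r.
  rewrite /form_dot; transitivity ((i.+1`!%:R)^-1 *
      \sum_(k < i.+1) \sum_j \sum_s A j s).
    congr (_ * _); rewrite -(eq_bigr _ (fun k _ => Dk k)) exchange_big /=.
    apply: eq_bigr => t _; rewrite /ext_d size_map size_tuple.
    by rewrite mulr_suml.
  rewrite sumr_const card_ord -[_ *+ i.+1]mulr_natl mulrA; congr (_ * _).
  by rewrite factS natrM invfM mulrAC mulVf ?mul1r.
have D2 : form_dot i w1 (codiff w2) x = - ((i`!%:R)^-1 * \sum_j \sum_s B j s).
  rewrite /form_dot -mulrN exchange_big /= -sumrN; congr (_ * _).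
  apply: eq_bigr => s _; rewrite /codiff.
  have -> : (- \sum_(j < n) interior (basis_vec j) (form_derive (basis_vec j) w2))
      x (map basis_vec s) = - \sum_(j < n)
        Cderive (basis_vec j) (w2 ^~ (basis_vec j :: e s)) x.
    by rewrite !fctE !fct_sumE.
  by rewrite rmorphN rmorph_sum mulrN mulr_sumr.
rewrite D1 D2 opprK -mulrDr -big_split mulr_sumr /=.
apply: eq_bigr => j _.
rewrite /form_dot invC Cderive_sum; last first.
  by move=> t; apply: CdifferentiableM_conj; apply: smoothW; [exact: s1|exact: s2].
congr (_ * _); rewrite -big_split; apply: eq_bigr => s _ /=.
rewrite Cderive_mul_conj //; apply: smoothW; [exact: s1|exact: s2].
Qed.

(* Branson's operator T'^(j)_(2l) on j-forms on R^n. *)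
Definition branson (j l : nat) w : cochain R n :=
  let v := iter l.-1 hodge_laplacian w in
  (n%:R / 2 - j%:R - l%:R : R[i]) *: ext_d (codiff v)
  + (n%:R / 2 - j%:R + l%:R : R[i]) *: codiff (ext_d v).

End Forms.

Arguments basis_vec R {n} j.

(* Operators from forms on R^n to forms on R^(n-1), where n = m.+1; the
   coordinate x_n has index [ord_max] and [lift ord_max] enumerates the others. *)
Section SymmetryBreaking.
Variables (R : realType) (m : nat).
Let n := m.+1.
Implicit Types (w : cochain R n) (mu u : R[i]).

Definition normal_vec : 'rV[R]_n := basis_vec R ord_max.

Definition hyperplane_incl (y : 'rV[R]_m) : 'rV[R]_n :=
  \row_j (if unlift ord_max j is Some k then y 0 k else 0).

(* Pull-back along the (linear) inclusion of {x_n = 0}. *)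
Definition Rest w : cochain R m :=
  fun y s => w (hyperplane_incl y) (map hyperplane_incl s).

Definition laplacian_tan w : cochain R n :=
  \sum_(j < m) form_derive (basis_vec R (lift ord_max j))
                 (form_derive (basis_vec R (lift ord_max j)) w).

Definition Dop_nat mu (b : nat) w : cochain R n :=
  \sum_(k < b./2.+1)
    ((2 ^ (b - k.*2))%:R / (k`! * (b - k.*2)`!)%:R
      * \prod_(uphalf b <= p < b - k) (mu + p%:R) : R[i]) *:
    iter k laplacian_tan (iter (b - k.*2) (form_derive normal_vec) w).

Definition Dop mu (b : int) w : cochain R n :=
  if b is Posz b' then Dop_nat mu b' w else 0.

Definition gammac mu (a : nat) : R[i] := if odd a then 1 else mu + a%:R / 2.

Definition mu_of (i : nat) u : R[i] := u + i%:R - (n%:R - 1) / 2.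

(* D^(i -> i-1)_(u,a) *)
Definition Dminus (i : nat) u (a : nat) w : cochain R m :=
  let mu := mu_of i u in
  Rest (- Dop (mu + 1) (a%:Z - 2) (ext_d (codiff (interior normal_vec w)))
        - gammac mu a *: Dop (mu + 1) (a%:Z - 1) (codiff w)
        + ((u + 2 * i%:R - n%:R) / 2) *: Dop mu a (interior normal_vec w)).

(* D^(i -> i)_(u,a) *)
Definition Dplus (i : nat) u (a : nat) w : cochain R m :=
  let mu := mu_of i u in
  Rest (Dop (mu + 1) (a%:Z - 2) (ext_d (codiff w))
        - gammac (mu - 1 / 2) a *:
            Dop mu (a%:Z - 1) (ext_d (interior normal_vec w))
        + ((u + a%:R) / 2) *: Dop mu a w).

End SymmetryBreaking.

Definition Kcoef (l a : nat) : nat := (\prod_(1 <= k < l.+1) (a./2 + k))%N.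

(* Main.v *)
From HB Require Import structures.
Require Import Defs.
From mathcomp Require Import all_boot all_order all_algebra.
From mathcomp Require Import all_classical all_reals all_analysis.
From mathcomp Require Import complex ring zify.
Import Order.TTheory GRing.Theory Num.Theory.
Import numFieldNormedType.Exports.
Local Open Scope ring_scope.
Local Open Scope complex_scope.

Set Implicit Arguments.
Unset Strict Implicit.
Unset Printing Implicit Defensive.

(** Everything is reduced to linear algebra with d and delta, and then to
    contiguity relations between explicit coefficients.

    Let E be the space of smooth, skew cochains of all degrees at once
    ([form_space]).  On E the flat derivatives [der v], the contractions
    [contr v], the differential [extd] and the codifferential [codif] are linear
    maps.  Mixed derivatives commute ([derive_comm]) and contractions
    anticommute, whence delta delta = 0.  Cartan's formula for constant fields,
    i_v d + d i_v = D_v ([contr_extd]), gives - (d delta + delta d) =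
    sum_j D_j D_j at once, and d d = 0 by induction on the number of arguments.

    For a form w put A_r = Rest (D_n^r w) and B_r = Rest (D_n^r i_n w), with D_n
    the normal derivative.  Since Rest d = d Rest and
    Rest delta = delta Rest - Rest i_n D_n, each of the operators D^(i -> i-1)
    and D^(i -> i) is an expression in d and delta on the hyperplane and in the
    sums D^mu_b X = sum_(2k+r=b) c(mu,k,r) Lap^k X_r, applied to X = A, B and
    to the shifted sequence B_(r+1) ([DminusE], [DplusE]).

    The coefficients c satisfy contiguity relations of Gegenbauer type
    ([Dsum_euler], [Dsum_step_mu], [Dsum_half]), valid for all mu.  At
    mu = - (l + a), which is what the choice of u amounts to, the factor
    mu + l + a vanishes, so that D^mu_(a+2l) has no terms with k < l and
    K D^mu_(a+2l) = Lap^l D^mu_a ([Dsum_iter_lap]).  Hence, with W the value of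
    D^(i -> i-1)_(u,a) and z = D^mu_a B,
      K D^(i -> i-1)_(u,a+2l) = Lap^(l-1) (Lap W - l d delta z),
    while W is coexact up to a multiple of z, so that d delta W is a multiple
    of d delta z.  Writing Lap = - (d delta + delta d), these two facts give the
    first claim ([branson_Dminus]); the second is the same computation with the
    roles of d delta and delta d exchanged ([branson_Dplus]). *)

Local Notation contract := Defs.interior.

(** * Symmetry of mixed directional derivatives *)

Section Schwarz.
Variables (R : realType) (V : normedModType R).
Implicit Types (g : V -> R) (x y v w : V).

Lemma line_derive g y v (s : R) : derivable g (y + s *: v) v ->
  is_derive s 1 (fun t : R => g (y + t *: v)) ('D_v g (y + s *: v)).
Proof.
have E : (fun h : R => h^-1 *: (((fun t : R => g (y + t *: v)) \o shift s) (h *: 1)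
           - g (y + s *: v))) =
         (fun h : R => h^-1 *: ((g \o shift (y + s *: v)) (h *: v) - g (y + s *: v))).
  apply/funext => h /=; congr (_ *: (g _ - _)).
  by rewrite [h *: 1]mulr1 scalerDl addrCA.
move=> dg; apply: DeriveDef; first by rewrite /derivable E.
by rewrite /derive E.
Qed.

Lemma mean_value_line g y v (h : R) : 0 < h -> (forall x, derivable g x v) ->
  exists2 s, 0 < s < h & g (y + h *: v) - g y = h * 'D_v g (y + s *: v).
Proof.
move=> h0 dg.
have dline (s : R) : is_derive s 1 (fun t : R => g (y + t *: v)) ('D_v g (y + s *: v)).
  exact: line_derive.
have [|s sh e] := MVT h0 (fun s _ => dline s).
  apply: derivable_within_continuous => s _.
  exact: ex_derive.
exists s; first by rewrite in_itv in sh.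
by rewrite scale0r addr0 subr0 mulrC in e.
Qed.

(** The second difference of g is the increment along v of y |-> g (y + h w) - g y;
    the mean value theorem along v, then along w, turns it into a mixed
    derivative at a nearby point. *)
Lemma second_difference g x v w (h : R) : 0 < h ->
  (forall y, derivable g y v) -> (forall y, derivable ('D_v g) y w) ->
  exists s t : R, [/\ 0 < s < h, 0 < t < h &
    g (x + h *: v + h *: w) - g (x + h *: v) - (g (x + h *: w) - g x)
    = h * h * 'D_w ('D_v g) (x + s *: v + t *: w)].
Proof.
move=> h0 dg ddg.
pose G y := g (y + h *: w) - g y.
have dshift y : is_derive y v (fun z => g (z + h *: w)) ('D_v g (y + h *: w)).
  have E : (fun k : R => k^-1 *: (((fun z => g (z + h *: w)) \o shift y) (k *: v)
           - g (y + h *: w))) =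
         (fun k : R => k^-1 *: ((g \o shift (y + h *: w)) (k *: v) - g (y + h *: w))).
    by apply/funext => k /=; rewrite addrA.
  apply: DeriveDef; first by rewrite /derivable E; exact: dg.
  by rewrite /derive E.
have dG y : derivable G y v.
  by apply: derivableB; [exact: ex_derive|exact: dg].
have [s sh e1] := mean_value_line x h0 dG.
have DG y : 'D_v G y = 'D_v g (y + h *: w) - 'D_v g y.
  rewrite deriveB; [by rewrite derive_val|exact: ex_derive|exact: dg].
have [t th e2] := mean_value_line (x + s *: v) h0 ddg.
exists s, t; split => //.
by rewrite -[RHS]mulrA -e2 -DG -e1.
Qed.

(** The second difference is symmetric in v and w, so the two mixed derivatives
    take a common value at two points that tend to x with h. *)
Lemma derive_comm g x v w :
  (forall y, derivable g y v) -> (forall y, derivable g y w) ->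
  (forall y, derivable ('D_v g) y w) -> (forall y, derivable ('D_w g) y v) ->
  {for x, continuous ('D_w ('D_v g))} -> {for x, continuous ('D_v ('D_w g))} ->
  'D_w ('D_v g) x = 'D_v ('D_w g) x.
Proof.
move=> dv dw dvw dwv cvw cwv; apply/eqP; rewrite -subr_eq0 -normr_le0.
apply/ler_addgt0Pr => e e0; rewrite add0r.
have e2 : 0 < e / 2 by rewrite divr_gt0.
have /cvgrPdist_lt /(_ _ e2) /nbhs_ballP[r1 /= r10 B1] := cvw.
have /cvgrPdist_lt /(_ _ e2) /nbhs_ballP[r2 /= r20 B2] := cwv.
pose r := Num.min r1 r2; have r0 : 0 < r by rewrite lt_min r10.
pose M := `|v| + `|w| + 1; have M0 : 0 < M by rewrite ltr_wpDl ?addr_ge0.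
(* With this step, x + s v + t w stays in the ball of radius r for s, t < h. *)
pose h := r / M; have h0 : 0 < h by rewrite divr_gt0.
have near s t : 0 < s < h -> 0 < t < h -> ball x r (x + s *: v + t *: w).
  move=> /andP[s0 sh] /andP[t0 th].
  rewrite -ball_normE /ball_ /= -addrA opprD addNKr normrN.
  rewrite (le_lt_trans (ler_normD _ _)) // !normrZ !gtr0_norm //.
  apply: (@le_lt_trans _ _ (h * `|v| + h * `|w|)).
    by apply: lerD; rewrite ler_wpM2r // ltW.
  rewrite -mulrDr -[ltRHS](divfK (lt0r_neq0 M0)) -/h ltr_pM2l //.
  by rewrite /M ltrDl.
have [s [t [sh th E1]]] := second_difference x h0 dv dvw.
have [s' [t' [sh' th' E2]]] := second_difference x h0 dw dwv.
have E : 'D_w ('D_v g) (x + s *: v + t *: w) = 'D_v ('D_w g) (x + s' *: w + t' *: v).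
  apply: (@mulfI _ (h * h)); first by rewrite mulf_neq0 ?lt0r_neq0.
  rewrite -[LHS]E1 -[RHS]E2.
  by rewrite [x + h *: w + _]addrAC !opprB addrACA [- _ - _]addrC addrACA.
have D1 : `|'D_w ('D_v g) x - 'D_w ('D_v g) (x + s *: v + t *: w)| < e / 2.
  by apply: B1; apply: le_ball (near _ _ sh th); rewrite ge_min lexx.
have D2 : `|'D_v ('D_w g) x - 'D_v ('D_w g) (x + s' *: w + t' *: v)| < e / 2.
  apply: B2; rewrite addrAC.
  by apply: le_ball (near _ _ th' sh'); rewrite ge_min lexx orbT.
rewrite -{}E in D2; move: D1 D2.
move: ('D_w ('D_v g) x) ('D_w ('D_v g) (_ + _)) ('D_v ('D_w g) x) => p q r'.
move=> D1 D2; rewrite [e]splitr -[p - r'](subrKA q) (le_trans (ler_normD _ _)) //.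
by rewrite ltW // ltrD // distrC.
Qed.
End Schwarz.

(** * Smooth complex functions *)

Section SmoothFunctions.
Variables (R : realType) (n : nat).
Implicit Types (f g : 'rV[R]_n -> R[i]^o) (v x : 'rV[R]_n).

Lemma derive_comb_real (a b : R) (h1 h2 h3 : 'rV[R]_n -> R) v x :
  differentiable h1 x -> differentiable h2 x -> differentiable h3 x ->
  differentiable (fun y => a * h1 y + b * h2 y + h3 y) x /\
  'D_v (fun y => a * h1 y + b * h2 y + h3 y) x
  = a * 'D_v h1 x + b * 'D_v h2 x + 'D_v h3 x.
Proof.
move=> d1 d2 d3.
have dv (h : 'rV[R]_n -> R) : differentiable h x -> derivable h x v by exact: diff_derivable.
have da : differentiable (a *: h1) x by exact: differentiableZ.
have db : differentiable (b *: h2) x by exact: differentiableZ.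
have dab : differentiable (a *: h1 + b *: h2) x by exact: differentiableD.
split; first exact: (differentiableD dab d3).
rewrite [LHS](deriveD (dv _ dab) (dv _ d3)); congr (_ + _).
rewrite (deriveD (dv _ da) (dv _ db)).
by rewrite (deriveZ a (dv _ d1)) (deriveZ b (dv _ d2)).
Qed.

Lemma Cderive_comb (c : R[i]) f g v x :
  Cdifferentiable f x -> Cdifferentiable g x ->
  Cdifferentiable (c *: f + g) x /\
  Cderive v (c *: f + g) x = c * Cderive v f x + Cderive v g x.
Proof.
case: c => a b [fr fi] [gr gi].
have ReE : (fun y => complex.Re (((a +i* b) *: f + g) y)) =
    (fun y => a * complex.Re (f y) + - b * complex.Im (f y) + complex.Re (g y)).
  apply/funext => y; rewrite !fctE /GRing.scale /=.
  case: (f y) (g y) => ? ? [? ?] /=.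
  by congr (_ + _ + _); rewrite mulNr.
have ImE : (fun y => complex.Im (((a +i* b) *: f + g) y)) =
    (fun y => a * complex.Im (f y) + b * complex.Re (f y) + complex.Im (g y)).
  by apply/funext => y; rewrite !fctE /GRing.scale /=; case: (f y) (g y) => ? ? [].
have [d1 e1] := derive_comb_real a (- b) v fr fi gr.
have [d2 e2] := derive_comb_real a b v fi fr gi.
rewrite /Cdifferentiable /Cderive ReE ImE e1 e2; split; first by split.
by simpc.
Qed.

Lemma smooth_Cderive v f : smooth f -> smooth (Cderive v f).
Proof. by move=> sf vs x; have := sf (rcons vs v) x; rewrite foldr_rcons. Qed.

Lemma smooth_comb (c : R[i]) f g : smooth f -> smooth g -> smooth (c *: f + g).
Proof.
move=> sf sg vs.
have -> : foldr (@Cderive R n) (c *: f + g) vs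
    = c *: (foldr (@Cderive R n) f vs : _ -> R[i]^o) + (foldr (@Cderive R n) g vs : _ -> R[i]^o).
  elim: vs => //= v vs ->; apply/funext => x.
  by have [_ ->] := Cderive_comb c v (sf vs x) (sg vs x).
by move=> x; have [] := Cderive_comb c 0 (sf vs x) (sg vs x).
Qed.

Lemma smooth_cst0 : smooth (0 : 'rV[R]_n -> R[i]^o).
Proof.
move=> vs; have -> : foldr (@Cderive R n) (0 : _ -> R[i]^o) vs = 0.
  elim: vs => //= v vs ->; apply/funext => x.
  by rewrite /Cderive /= !derive_cst.
by move=> x; split; exact: differentiable_cst.
Qed.

Lemma derive_comm_diff (h : 'rV[R]_n -> R) u v x :
  (forall y, differentiable h y) ->
  (forall y, differentiable ('D_v h) y) -> (forall y, differentiable ('D_u h) y) ->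
  differentiable ('D_u ('D_v h)) x -> differentiable ('D_v ('D_u h)) x ->
  'D_u ('D_v h) x = 'D_v ('D_u h) x.
Proof.
move=> d0 dv du duv dvu.
have H0 y t : derivable h y t by exact: diff_derivable (d0 y).
have Hv y t : derivable ('D_v h) y t by exact: diff_derivable (dv y).
have Hu y t : derivable ('D_u h) y t by exact: diff_derivable (du y).
exact: (@derive_comm _ _ h x v u (H0 ^~ v) (H0 ^~ u) (Hv ^~ u) (Hu ^~ v)
  (differentiable_continuous duv) (differentiable_continuous dvu)).
Qed.

Lemma Cderive_comm f u v x : smooth f ->
  Cderive u (Cderive v f) x = Cderive v (Cderive u f) x.
Proof.
move=> sf; have d0 y := sf [::] y; have d1 v' y := sf [:: v'] y.
have d2 u' v' := sf [:: u'; v'] x; rewrite /Cdifferentiable /Cderive /= in d0 d1 d2.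
have E1 := derive_comm_diff (fun y => proj1 (d0 y)) (fun y => proj1 (d1 v y))
    (fun y => proj1 (d1 u y)) (proj1 (d2 u v)) (proj1 (d2 v u)).
have E2 := derive_comm_diff (fun y => proj2 (d0 y)) (fun y => proj2 (d1 v y))
    (fun y => proj2 (d1 u y)) (proj2 (d2 u v)) (proj2 (d2 v u)).
exact: (f_equal2 (@Complex R) E1 E2).
Qed.

End SmoothFunctions.

(** * The space of smooth skew cochains *)

(** All degrees at once, so that d, delta and the contractions are endomorphisms
    of one space.  Alternation is expressed by the exchange of neighbouring
    arguments, which suits inductions on the list of arguments. *)
Definition skew_smooth (R : realType) n : {pred cochain R n} := fun w =>
  `[< (forall s, smooth (w ^~ s)) /\
      (forall x s1 s2 u v, w x (s1 ++ u :: v :: s2) = - w x (s1 ++ v :: u :: s2)) >].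

Lemma skew_smooth_submod (R : realType) n : submod_closed (@skew_smooth R n).
Proof.
split=> [|c w1 w2 /asboolP[s1 a1] /asboolP[s2 a2]]; apply/asboolP; split.
- by move=> s; exact: smooth_cst0.
- by move=> *; rewrite oppr0.
- move=> s; exact: smooth_comb (s1 s) (s2 s).
- move=> x t1 t2 u v; have E w w' s : (c *: w + w' : cochain R n) x s = c *: w x s + w' x s by [].
  by rewrite !E a1 a2 scalerN opprD.
Qed.
HB.instance Definition _ R n :=
  GRing.isSubmodClosed.Build _ _ (@skew_smooth R n) (@skew_smooth_submod R n).

Record form_space (R : realType) n :=
  FormSpace { form_val :> cochain R n; form_valP : form_val \in @skew_smooth R n }.
HB.instance Definition _ R n := [isSub for @form_val R n].
HB.instance Definition _ R n := [Choice of form_space R n by <:].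
HB.instance Definition _ R n := [SubChoice_isSubLmodule of form_space R n by <:].

Section Cochains.
Variables (R : realType) (n : nat).
Implicit Types (w : cochain R n) (u v x : 'rV[R]_n).

Lemma ext_d_nil w x : ext_d w x [::] = 0.
Proof. by rewrite /ext_d big_ord0. Qed.

(** Cartan's formula i_v d = D_v - d i_v for constant v; as every statement about
    [ext_d] is a statement about its values on lists of vectors, it reduces them
    to inductions on the list. *)
Lemma ext_d_cons w x v s :
  ext_d w x (v :: s) = form_derive v w x s - ext_d (contract v w) x s.
Proof.
rewrite /ext_d big_ord_recl /= mul1r drop0; congr (_ + _).
by rewrite -sumrN; apply: eq_bigr => k _; rewrite /bump /= add1n exprS mulN1r mulNr.
Qed.

Lemma skew_smoothP w : reflect
  ((forall s, smooth (w ^~ s)) /\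
   (forall x s1 s2 u v, w x (s1 ++ u :: v :: s2) = - w x (s1 ++ v :: u :: s2)))
  (w \in @skew_smooth R n).
Proof. exact: asboolP. Qed.

Lemma form_derive_comb w1 w2 c v : w1 \in @skew_smooth R n -> w2 \in @skew_smooth R n ->
  form_derive v (c *: w1 + w2) = c *: form_derive v w1 + form_derive v w2.
Proof.
move=> /skew_smoothP[s1 _] /skew_smoothP[s2 _]; apply/funext => x; apply/funext => s.
by have [] := Cderive_comb c v (smoothW x (s1 s)) (smoothW x (s2 s)).
Qed.

Lemma skew_smooth_contract v w : w \in @skew_smooth R n -> contract v w \in @skew_smooth R n.
Proof.
move=> /skew_smoothP[sw aw]; apply/skew_smoothP; split=> [s|x s1]; first exact: sw.
exact: (aw x (v :: s1)).
Qed.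

Lemma skew_smooth_derive v w : w \in @skew_smooth R n -> form_derive v w \in @skew_smooth R n.
Proof.
move=> wF; have /skew_smoothP[sw aw] := wF; apply/skew_smoothP; split=> [s|x s1 s2 a b].
  exact: (smooth_Cderive v (sw s)).
have E : w ^~ (s1 ++ a :: b :: s2) = (-1) *: (w ^~ (s1 ++ b :: a :: s2)) + 0.
  by apply/funext => y; rewrite aw addr0 scaleN1r.
have [_ D] := Cderive_comb (-1) v (smoothW x (sw (s1 ++ b :: a :: s2))) (smoothW x (@smooth_cst0 R n)).
rewrite /form_derive E D mulN1r -[RHS]addr0; congr (- _ + _).
by rewrite /Cderive !derive_cst.
Qed.

Lemma ext_d_comb w1 w2 c : w1 \in @skew_smooth R n -> w2 \in @skew_smooth R n ->
  ext_d (c *: w1 + w2) = c *: ext_d w1 + ext_d w2.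
Proof.
move=> w1F w2F; apply/funext => x; apply/funext => s.
have -> : (c *: ext_d w1 + ext_d w2) x s = c * ext_d w1 x s + ext_d w2 x s by [].
rewrite /ext_d mulr_sumr -big_split; apply: eq_bigr => k _ /=.
by rewrite form_derive_comb // [_ *: _ + _]fctE !fctE mulrDr mulrCA.
Qed.

(** Skewness passes from [contract a w] to [ext_d w] by Cartan's formula, except in
    the first two arguments, where i_v i_u d = i_v D_u - D_v i_u + d i_v i_u is
    visibly antisymmetric in u and v. *)
Lemma skew_smooth_ext_d w : w \in @skew_smooth R n -> ext_d w \in @skew_smooth R n.
Proof.
move=> wF; apply/skew_smoothP; split.
  move=> s; elim: s w wF => [|v s IH] w wF.
    rewrite (_ : _ ^~ _ = 0) ?ext_d_nil; first exact: smooth_cst0.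
    by apply/funext => x; exact: ext_d_nil.
  have -> : ext_d w ^~ (v :: s) = -1 *: (ext_d (contract v w) ^~ s : _ -> R[i]^o) + form_derive v w ^~ s.
    by apply/funext => x; rewrite ext_d_cons addrC scaleN1r.
  apply: smooth_comb; first exact/IH/skew_smooth_contract.
  by have /skew_smoothP[] := skew_smooth_derive v wF.
move=> x s1; elim: s1 w wF => [|a s1 IH] w wF s2 u v /=; last first.
  rewrite !ext_d_cons (IH _ (skew_smooth_contract a wF)).
  by have /skew_smoothP[_ ->] := skew_smooth_derive a wF; rewrite opprD.
rewrite !ext_d_cons.
have -> : contract v (contract u w) = -1 *: contract u (contract v w) + 0.
  apply/funext => y; apply/funext => s; have /skew_smoothP[_ aw] := wF.
  rewrite addr0; exact: etrans (aw y [::] s u v) (esym (scaleN1r _)).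
have iF := skew_smooth_contract u (skew_smooth_contract v wF).
rewrite ext_d_comb ?rpred0 //.
have -> : ext_d (0 : cochain R n) = 0.
  by have := ext_d_comb 1 (rpred0 _) (rpred0 _); rewrite !scale1r addr0 -[LHS]addr0 => /addrI <-.
have -> (e : cochain R n) : (-1 *: e + 0) x s2 = - e x s2 by rewrite addr0; exact: scaleN1r.
by rewrite !opprB addrA.
Qed.
End Cochains.

(** * The calculus of d, delta and contractions *)

Section FormOperators.
Variables (R : realType) (n : nat).
Notation F := (form_space R n).
Implicit Types (w : F) (u v x : 'rV[R]_n).

Definition der v w : F := FormSpace (skew_smooth_derive v (form_valP w)).
Definition contr v w : F := FormSpace (skew_smooth_contract v (form_valP w)).
Definition extd w : F := FormSpace (skew_smooth_ext_d (form_valP w)).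

Arguments der : simpl never.
Arguments contr : simpl never.
Arguments extd : simpl never.

Fact der_linear v : linear (der v).
Proof. move=> c a b; apply: val_inj; exact: form_derive_comb (form_valP a) (form_valP b). Qed.
HB.instance Definition _ v := GRing.isLinear.Build R[i] F F _ (der v) (der_linear v).

Fact contr_linear v : linear (contr v).
Proof. by move=> c a b; apply: val_inj. Qed.
HB.instance Definition _ v := GRing.isLinear.Build R[i] F F _ (contr v) (contr_linear v).

Fact extd_linear : linear extd.
Proof. move=> c a b; apply: val_inj; exact: ext_d_comb (form_valP a) (form_valP b). Qed.
HB.instance Definition _ := GRing.isLinear.Build R[i] F F _ extd extd_linear.

Lemma der_comm u v w : der u (der v w) = der v (der u w).
Proof.
apply: val_inj; apply/funext => x; apply/funext => s.
by have /skew_smoothP[sw _] := form_valP w; exact: Cderive_comm.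
Qed.

Lemma der_contr u v w : der u (contr v w) = contr v (der u w).
Proof. exact: val_inj. Qed.

Lemma contr_anticomm u v w : contr u (contr v w) = - contr v (contr u w).
Proof.
apply: val_inj; apply/funext => x; apply/funext => s.
by have /skew_smoothP[_ aw] := form_valP w; exact: (aw x [::]).
Qed.

Lemma contr_extd v w : contr v (extd w) = der v w - extd (contr v w).
Proof.
apply: val_inj; apply/funext => x; apply/funext => s.
exact: ext_d_cons.
Qed.

(** By Cartan's formula the claim for w on v :: s follows from the claim for
    i_v w on s and the commutation of D_u with D_v. *)
Lemma der_extd u w : der u (extd w) = extd (der u w).
Proof.
apply: val_inj; apply/funext => x; apply/funext => s.
elim: s w x => [|v s IH] w x.
  rewrite [RHS]ext_d_nil /form_val /= /form_derive.
  have -> : ext_d w ^~ [::] = cst 0 by apply/funext => y; exact: ext_d_nil.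
  by rewrite /Cderive !derive_cst.
transitivity (form_val (contr v (der u (extd w))) x s); first by [].
rewrite -der_contr contr_extd.
have -> : der u (der v w - extd (contr v w)) = der v (der u w) - der u (extd (contr v w)).
  by rewrite linearB /= der_comm.
transitivity (form_val (contr v (extd (der u w))) x s); last by [].
rewrite contr_extd -der_contr.
exact: (congr1 (fun t => form_val (der v (der u w)) x s - t) (IH _ _)).
Qed.

(** Cartan's formula twice: i_v d d w = D_v d w - d D_v w + d d i_v w
    = d d i_v w. *)
Lemma extd_extd w : extd (extd w) = 0.
Proof.
apply: val_inj; apply/funext => x; apply/funext => s.
elim: s w x => [|v s IH] w x; first exact: ext_d_nil.
transitivity (form_val (contr v (extd (extd w))) x s); first by [].
have -> : contr v (extd (extd w)) = extd (extd (contr v w)).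
  by rewrite contr_extd der_extd contr_extd linearB opprB addrC subrK.
exact: IH.
Qed.

Let e j := basis_vec R j : 'rV[R]_n.

Definition codif w : F := - \sum_(j < n) contr (e j) (der (e j) w).

Fact codif_linear : linear codif.
Proof.
move=> c a b; rewrite /codif scalerN scaler_sumr -opprD -big_split.
by congr (- _); apply: eq_bigr => j _; rewrite !linearP.
Qed.
HB.instance Definition _ := GRing.isLinear.Build R[i] F F _ codif codif_linear.

Lemma val_codif w : codif w = codiff w :> cochain R n.
Proof. by rewrite -[LHS]/(\val (codif w)) /codif raddfN raddf_sum. Qed.

Lemma der_codif v w : der v (codif w) = codif (der v w).
Proof.
rewrite /codif linearN linear_sum /=; congr (- _).
by apply: eq_bigr => j _; rewrite der_contr der_comm.
Qed.

Lemma contr_codif v w : contr v (codif w) = - codif (contr v w).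
Proof.
rewrite /codif linearN linear_sum /=; congr (- _); rewrite -sumrN.
by apply: eq_bigr => j _; rewrite contr_anticomm der_contr.
Qed.

(** Contractions anticommute with delta, so moving the outer ones inside gives
    delta delta = - delta delta. *)
Lemma codif_codif w : codif (codif w) = 0.
Proof.
have H : codif (codif w) = - codif (codif w).
  transitivity (codif (\sum_(j < n) contr (e j) (der (e j) w))).
    rewrite {1}/codif [RHS]linear_sum -sumrN; apply: eq_bigr => j _.
    by rewrite der_codif contr_codif opprK.
  by rewrite -linearN; congr codif; rewrite /codif opprK.
apply/eqP; move/eqP: H; rewrite -addr_eq0 -mulr2n -scaler_nat scaler_eq0.
by rewrite pnatr_eq0.
Qed.

(** The Hodge Laplacian of flat space acts coefficientwise: term by term,
    d i_j D_j + i_j D_j d = (d i_j + i_j d) D_j = D_j D_j. *)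
Lemma extd_codif w : - (extd (codif w) + codif (extd w)) = \sum_(j < n) der (e j) (der (e j) w).
Proof.
rewrite /codif linearN linear_sum -opprD opprK -big_split; apply: eq_bigr => j _ /=.
by rewrite der_extd contr_extd addrC subrK.
Qed.
End FormOperators.

(** * Restriction to the hyperplane *)

Section Restriction.
Variables (R : realType) (m : nat).
Notation n := m.+1.
Notation incl := (@hyperplane_incl R m).
Implicit Types (f : 'rV[R]_n -> R[i]^o).

Lemma hyperplane_inclP c u v : incl (c *: u + v) = c *: incl u + incl v.
Proof.
apply/rowP => j; rewrite !mxE.
by case: unliftP => [k _|_]; rewrite ?mxE // mulr0 addr0.
Qed.

Lemma hyperplane_incl_basis (j : 'I_m) :
  incl (basis_vec R j) = basis_vec R (lift ord_max j).
Proof.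
apply/rowP => k; rewrite !mxE /=; case: unliftP => [k' ->|->].
  by rewrite mxE /= (inj_eq lift_inj).
by rewrite (negbTE (neq_lift _ _)).
Qed.

Lemma differentiable_incl y : differentiable (incl : 'rV[R]_m -> 'rV[R]_n) y.
Proof.
have -> : (incl : 'rV[R]_m -> 'rV[R]_n)
    = \sum_(j < m) (fun z : 'rV[R]_m => z 0 j *: basis_vec R (lift ord_max j)).
  apply/funext => z; rewrite fct_sumE.
  rewrite {1}[z]row_sum_delta.
  elim/big_rec2: _ => [|j a b _ <-].
    by apply/rowP => k; rewrite !mxE; case: unliftP => *; rewrite ?mxE.
  by rewrite hyperplane_inclP hyperplane_incl_basis.
apply: differentiable_sum => j; apply: differentiableZl; exact: differentiable_coord.
Qed.

Lemma derive_incl (h : 'rV[R]_n -> R) v y :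
  'D_v (fun z => h (incl z)) y = 'D_(incl v) h (incl y).
Proof.
rewrite /derive; suff -> : (fun k : R => k^-1 *: (((fun z => h (incl z)) \o shift y) (k *: v) - h (incl y)))
   = (fun k : R => k^-1 *: ((h \o shift (incl y)) (k *: incl v) - h (incl y))) by [].
by apply/funext => k /=; rewrite hyperplane_inclP.
Qed.

Lemma Cderive_incl f v :
  Cderive v (fun z => f (incl z)) = (fun z => Cderive (incl v) f (incl z)).
Proof.
apply/funext => y; exact: (f_equal2 (@Complex R) (derive_incl (fun z => complex.Re (f z)) v y)
  (derive_incl (fun z => complex.Im (f z)) v y)).
Qed.

Lemma smooth_incl f : smooth f -> smooth (fun z => f (incl z)).
Proof.
move=> sf vs.
have -> : foldr (@Cderive R m) (fun z => f (incl z)) vs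
   = (fun z => foldr (@Cderive R n) f (map incl vs) (incl z)).
  by elim: vs => //= v vs ->; exact: Cderive_incl.
move=> y; have [dr di] := sf (map incl vs) (incl y).
by split; [exact: (differentiable_comp (differentiable_incl y) dr)
          |exact: (differentiable_comp (differentiable_incl y) di)].
Qed.

Lemma skew_smooth_Rest (w : cochain R n) :
  w \in @skew_smooth R n -> Rest w \in @skew_smooth R m.
Proof.
move=> /skew_smoothP[sw aw]; apply/skew_smoothP; split.
  by move=> s; exact: (smooth_incl (sw (map incl s))).
by move=> x s1 s2 u v; rewrite /Rest !map_cat /= aw.
Qed.

Definition restr (w : form_space R n) : form_space R m :=
  FormSpace (skew_smooth_Rest (form_valP w)).

Fact restr_linear : linear restr.
Proof. by move=> c a b; apply: val_inj. Qed.
HB.instance Definition _ :=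
  GRing.isLinear.Build R[i] (form_space R n) (form_space R m) _ restr restr_linear.
Arguments restr : simpl never.

Implicit Types w : form_space R n.

Lemma restr_contr v w : restr (contr (incl v) w) = contr v (restr w).
Proof. exact: val_inj. Qed.

Lemma restr_der v w : restr (der (incl v) w) = der v (restr w).
Proof.
apply: val_inj; apply/funext => y; apply/funext => s.
exact: (esym (congr1 (fun g => g y) (Cderive_incl (form_val w ^~ (map incl s)) v))).
Qed.

Lemma restr_extd w : restr (extd w) = extd (restr w).
Proof.
apply: val_inj; apply/funext => y; apply/funext => s.
elim: s w => [|v s IH] w; first by rewrite [RHS]ext_d_nil; exact: ext_d_nil.
transitivity (form_val (contr v (restr (extd w))) y s); first by [].
have -> : contr v (restr (extd w)) = der v (restr w) - restr (extd (contr (incl v) w)).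
  by rewrite -restr_contr contr_extd linearB /= restr_der.
transitivity (form_val (contr v (extd (restr w))) y s); last by [].
rewrite contr_extd -restr_contr.
exact: (congr1 (fun t => form_val (der v (restr w)) y s - t) (IH _)).
Qed.

Notation nv := (normal_vec R m).

(** All summands of the ambient delta are tangential and commute with restriction,
    except the one of index n. *)
Lemma restr_codif w : restr (codif w) = codif (restr w) - restr (contr nv (der nv w)).
Proof.
rewrite /codif linearN linear_sum (bigD1_ord ord_max) //= opprD addrC; congr (- _ + _).
by apply: eq_bigr => j _; rewrite -hyperplane_incl_basis restr_contr restr_der.
Qed.

Definition lap_tan w : form_space R n :=
  \sum_(j < m) der (basis_vec R (lift ord_max j)) (der (basis_vec R (lift ord_max j)) w).

Lemma val_lap_tan w : lap_tan w = laplacian_tan w :> cochain R n.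
Proof. by rewrite -[LHS]/(\val (lap_tan w)) /lap_tan raddf_sum. Qed.

Lemma restr_lap_tan w : restr (lap_tan w) = - (extd (codif (restr w)) + codif (extd (restr w))).
Proof.
rewrite extd_codif /lap_tan linear_sum; apply: eq_bigr => j _.
by rewrite -hyperplane_incl_basis /= !restr_der.
Qed.
End Restriction.

(** * The coefficients of the Gegenbauer-type operators *)

Section Coefficients.
Variable R : realType.
Notation C := R[i].
Implicit Types mu : C.

(** Coefficient of Lap^k D_n^r in D^mu_(2k+r).  Indexing by (k, r) instead of
    (b, k) makes the contiguity relations below hold without boundary cases. *)
Definition Dcoef mu (k r : nat) : C :=
  (2 ^ r)%:R / (k`! * r`!)%:R
  * \prod_(k + uphalf r <= p < k + r) (mu + p%:R).

Lemma natr_neq0 (j : nat) : (0 < j)%N -> j%:R != 0 :> C.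
Proof. by rewrite pnatr_eq0; case: j. Qed.

Lemma fact_neq0 (j : nat) : j`!%:R != 0 :> C.
Proof. exact: natr_neq0 (fact_gt0 j). Qed.

Lemma prod_addn1 mu (i j : nat) :
  \prod_(i <= p < j) (mu + 1 + p%:R) = \prod_(i.+1 <= p < j.+1) (mu + p%:R).
Proof.
rewrite big_add1 /=; apply: eq_bigr => p _.
by rewrite -addn1 natrD; ring.
Qed.

Lemma leq_uphalf r : (uphalf r <= r)%N.
Proof. lia. Qed.

Lemma Dcoef_shift_k mu k r : Dcoef (mu + 1) k r = k.+1%:R * Dcoef mu k.+1 r.
Proof.
rewrite /Dcoef prod_addn1 !addSn factS !natrM.
by field; rewrite !fact_neq0 nat1r natr_neq0.
Qed.

Lemma Dcoef_shift_r mu k r :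
  r.+1%:R * Dcoef mu k r.+1 = 2 * (gammac mu (k.*2 + r.+1) * Dcoef (mu + 1) k r).
Proof.
rewrite /Dcoef prod_addn1 factS expnS !natrM.
have -> : gammac mu (k.*2 + r.+1) * ((2 ^ r)%:R / (k`!%:R * r`!%:R) *
     \prod_((k + uphalf r).+1 <= p < (k + r).+1) (mu + p%:R)) =
   (2 ^ r)%:R / (k`!%:R * r`!%:R) *
    \prod_(k + uphalf r.+1 <= p < k + r.+1) (mu + p%:R); last first.
  by field; rewrite !fact_neq0 nat1r natr_neq0.
rewrite mulrCA; congr (_ * _).
rewrite /gammac oddD odd_double /=; have [ro|re] := boolP (odd r).
  have -> : (r./2.+1 = uphalf r)%N by lia.
  rewrite !addnS [RHS]big_nat_recl; last by move: ro; lia.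
  rewrite big_add1 /=; congr (_ * _).
  have -> : ((k.*2 + r).+1 = (k + uphalf r) * 2)%N by move: ro; lia.
  by rewrite natrM mulfK // natr_neq0.
rewrite mul1r.
have -> : uphalf r = r./2 by move: re; lia.
by rewrite !addnS.
Qed.

Lemma Dcoef_shift_mu mu k r :
  (mu + (k + uphalf r)%:R) * Dcoef (mu + 1) k r = (mu + (k + r)%:R) * Dcoef mu k r.
Proof.
rewrite /Dcoef prod_addn1 2![(_ + _) * (_ * _)]mulrCA; congr (_ * _).
have ur := leq_uphalf r.
rewrite [RHS]mulrC -big_nat_recr ?leq_add2l //=.
by rewrite [RHS]big_nat_recl ?leq_add2l // big_add1.
Qed.

Lemma Dcoef_half mu k r :
  Dcoef (mu + 1) k r + gammac (mu - 1 / 2) (k.*2 + r.+2) * Dcoef mu k r.+1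
  = gammac mu (k.*2 + r.+2) * Dcoef (mu + 1) k r.+1.
Proof.
rewrite /Dcoef !prod_addn1 factS expnS !natrM /gammac oddD odd_double /= negbK.
rewrite !addnS uphalfE /=.
have f0 := fact_neq0; have n2 : (2 : C) != 0 by exact: natr_neq0.
have r2 : 1 + r%:R != 0 :> C by rewrite nat1r natr_neq0.
have [ro|re] := boolP (odd r).
  have -> : uphalf r = r./2.+1 by move: ro; lia.
  rewrite !addnS [\prod_(_ <= p < _.+2) _]big_nat_recr /=; last by move: ro; lia.
  rewrite [\prod_((k + r./2).+1 <= p < _) _]big_nat_recl /=; last by move: ro; lia.
  rewrite big_add1 /=.
  have e : r%:R = 1 + r./2%:R + r./2%:R :> C.
    by rewrite -[1]/(1%:R) -!natrD; congr (_%:R); move: ro; lia.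
  rewrite -!nat1r !natrD ?e; rewrite e in r2.
  by field; rewrite !f0 ?n2 ?r2.
have -> : uphalf r = r./2 by move: re; lia.
have e : r%:R = r./2%:R + r./2%:R :> C.
  by rewrite -!natrD; congr (_%:R); move: re; lia.
have -> : ((k.*2 + r).+2 = (k + r./2).+1 * 2)%N by move: re; lia.
rewrite natrM mulfK //.
rewrite [RHS]mulrCA -big_ltn; last by move: re; lia.
rewrite [\prod_(_ <= p < _.+2) _]big_nat_recr /=; last by move: re; lia.
rewrite -!nat1r !natrD ?e; rewrite e in r2.
by field; rewrite !f0 ?n2 ?r2.
Qed.

Lemma Kcoef_fact l a : (Kcoef l a * (a./2)`! = (a./2 + l)`!)%N.
Proof.
elim: l => [|l IH]; first by rewrite /Kcoef big_geq // mul1n addn0.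
by rewrite /Kcoef big_nat_recr //= mulnAC -/(Kcoef l a) IH addnS factS mulnC.
Qed.

(** Up to sign the factors are e+1, ..., e+N. *)
Lemma prod_falling (s N e : nat) :
  e`!%:R * \prod_(s <= p < s + N) (- (s + N + e)%:R + p%:R) = (-1) ^+ N * (N + e)`!%:R :> C.
Proof.
elim: N s => [|N IH] s; first by rewrite addn0 big_geq // mulr1 mul1r.
rewrite big_ltn ?addnS ?ltnS ?leq_addr // mulrCA -!addSn IH.
by rewrite exprS factS !addSn -!addnS !natrM !natrD; ring.
Qed.

(** For k < l the product contains the factor p = l + a. *)
Lemma Dcoef_vanish l a k r : (k.*2 + r = a + l.*2)%N -> (k < l)%N ->
  Dcoef (- (l + a)%:R) k r = 0.
Proof.
move=> e kl; rewrite /Dcoef (big_cat_nat (n := (l + a)%N)) /=; try lia.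
by rewrite [X in _ * (_ * X)]big_ltn ?addNr ?mul0r ?mulr0 //; lia.
Qed.

(** With N = [r/2], the two products are (N+k+l)!/(k+l)! and (N+k)!/k! up to
    the same sign (-1)^N, and K = (N+k+l)!/(N+k)!. *)
Lemma Dcoef_shift_Kcoef l k r (a := (k.*2 + r)%N) (mu := - (l + a)%:R) :
  Dcoef mu k r = (Kcoef l a)%:R * Dcoef mu (k + l) r.
Proof.
have ea : (a./2 = r./2 + k)%N by rewrite /a; lia.
have er : (r = uphalf r + r./2)%N by lia.
have Hk := prod_falling (k + uphalf r) r./2 (k + l).
have Hl := prod_falling (k + l + uphalf r) r./2 k.
have HK := Kcoef_fact l a; rewrite ea in HK.
have sk : (k + uphalf r + r./2 + (k + l) = l + a)%N by rewrite /a; lia.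
have sl : (k + l + uphalf r + r./2 + k = l + a)%N by rewrite /a; lia.
rewrite sk (addnA r./2) -HK natrM -[(_ + uphalf r + _)%N]addnA -er -/mu in Hk.
rewrite sl -[(_ + uphalf r + _)%N]addnA -er -/mu in Hl.
have f0 := fact_neq0.
apply: (mulfI (f0 k)); apply: (mulfI (f0 (k + l)%N)).
rewrite /Dcoef !natrM.
transitivity (k`!%:R * (2 ^ r)%:R / (k`!%:R * r`!%:R) *
  ((k + l)`!%:R * \prod_(k + uphalf r <= p < k + r) (mu + p%:R))).
  by field; rewrite !f0.
rewrite Hk.
transitivity ((Kcoef l a)%:R * (2 ^ r)%:R / r`!%:R *
  ((-1) ^+ r./2 * (r./2 + k)`!%:R) : C); first by field; rewrite !f0.
rewrite -Hl.
by field; rewrite !f0.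
Qed.
End Coefficients.

(** * Identities between the operators *)

Section Sums.
Variable R : realType.
Notation C := R[i].
Variables (V : lmodType C) (L : {linear V -> V}).
Implicit Types (g : nat -> nat -> C) (X : nat -> V) (mu : C).

(** With Lap in degree 2 and the index of X in degree 1, the part of degree b of
    a power series in Lap and D_n; X_r stands for the r-th normal derivative, so
    that D_n acts as the shift of X. *)
Definition homog_sum g (b : nat) X : V :=
  \sum_(k < b./2.+1) g k (b - k.*2)%N *: iter k L (X (b - k.*2)%N).

Definition Dsum mu (b : int) X : V :=
  if b is Posz b' then homog_sum (Dcoef mu) b' X else 0.

Definition shift_seq X : nat -> V := fun r => X r.+1.

Lemma eq_homog_sum g h b X : (forall k r, (k.*2 + r = b)%N -> g k r = h k r) ->
  homog_sum g b X = homog_sum h b X.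
Proof.
move=> gh; apply: eq_bigr => k _; rewrite gh //.
by have := ltn_ord k; lia.
Qed.

Lemma homog_sumD g h b X :
  homog_sum g b X + homog_sum h b X = homog_sum (fun k r => g k r + h k r) b X.
Proof. by rewrite -big_split; apply: eq_bigr => k _; rewrite scalerDl. Qed.

Lemma homog_sumZ c g b X : c *: homog_sum g b X = homog_sum (fun k r => c * g k r) b X.
Proof. by rewrite scaler_sumr; apply: eq_bigr => k _; rewrite scalerA. Qed.

Lemma homog_sum_lap g b X :
  L (homog_sum g b X) = homog_sum (fun k r => if k is k'.+1 then g k' r else 0) b.+2 X.
Proof.
rewrite /homog_sum [RHS]big_ord_recl scale0r add0r linear_sum.
by apply: eq_bigr => k _; rewrite linearZ doubleS !subSS.
Qed.

Lemma homog_sum_iter_lap j g b X : iter j L (homog_sum g b X) =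
  homog_sum (fun k r => if (k < j)%N then 0 else g (k - j)%N r) (b + 2 * j) X.
Proof.
elim: j => [|j IH].
  by rewrite muln0 addn0; apply: eq_homog_sum => k r _; rewrite subn0.
rewrite iterS IH homog_sum_lap (_ : b + 2 * j.+1 = (b + 2 * j).+2)%N; last by lia.
by apply: eq_homog_sum => -[|k] r _.
Qed.

Lemma homog_sum_shift_seq g b X :
  homog_sum g b (shift_seq X) = homog_sum (fun k r => if r is r'.+1 then g k r' else 0) b.+1 X.
Proof.
have E (k : nat) : (k <= b./2)%N -> (b.+1 - k.*2 = (b - k.*2).+1)%N by lia.
rewrite /homog_sum /= uphalf_half; case: (boolP (odd b)) => bo; last first.
  by rewrite add0n; apply: eq_bigr => k _; rewrite E // -ltnS ltn_ord.
rewrite add1n [RHS]big_ord_recr /= (_ : (b.+1 - _ = 0)%N); last by lia.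
rewrite scale0r addr0.
by apply: eq_bigr => k _ /=; rewrite E // -ltnS ltn_ord.
Qed.

Lemma iter_morph (f : V -> V) j v : (forall v, f (L v) = L (f v)) ->
  f (iter j L v) = iter j L (f v).
Proof. by move=> fL; elim: j => //= j <-. Qed.

Lemma iter_linearZ j c v : iter j L (c *: v) = c *: iter j L v.
Proof. by rewrite -(@iter_morph ( *:%R c)) // => u; rewrite linearZ. Qed.

Lemma iter_linearN j u : iter j L (- u) = - iter j L u.
Proof. by elim: j => //= j ->; rewrite linearN. Qed.

Lemma iter_linearB j u v : iter j L (u - v) = iter j L u - iter j L v.
Proof. by elim: j => //= j ->; rewrite linearB. Qed.

Lemma iter_linearD j u v : iter j L (u + v) = iter j L u + iter j L v.
Proof. by elim: j => //= j ->; rewrite linearD. Qed.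

Lemma homog_sum_morph (f : {linear V -> V}) g b X : (forall v, f (L v) = L (f v)) ->
  f (homog_sum g b X) = homog_sum g b (f \o X).
Proof.
move=> fL; rewrite linear_sum; apply: eq_bigr => k _; rewrite linearZ /=.
by rewrite iter_morph.
Qed.

Lemma Dsum_morph (f : {linear V -> V}) mu b X : (forall v, f (L v) = L (f v)) ->
  f (Dsum mu b X) = Dsum mu b (f \o X).
Proof. by case: b => b fL /=; rewrite ?linear0 ?homog_sum_morph. Qed.

Lemma DsumB mu b X Y :
  Dsum mu b X - Dsum mu b Y = Dsum mu b (fun r => X r - Y r).
Proof.
case: b => b; rewrite /Dsum ?subr0 // /homog_sum -sumrB; apply: eq_bigr => k _.
by rewrite iter_linearB scalerBr.
Qed.

(** Multiplication by Lap at mu + 1 weights the terms of D^mu_a by k; with the next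
    lemma, where the normal derivative weights them by r/2, and 2k + r = a, this
    gives [Dsum_euler]. *)
Lemma Dsum_lap mu a X : L (Dsum (mu + 1) (a%:Z - 2) X) =
  homog_sum (fun k r => k%:R * Dcoef mu k r) a X.
Proof.
case: a => [|[|a]]; last first.
- rewrite (_ : a.+2%:Z - 2 = a) /=; last by lia.
  rewrite homog_sum_lap; apply: eq_homog_sum => -[|k] r _; first by rewrite mul0r.
  exact: Dcoef_shift_k.
- by rewrite linear0 /homog_sum big_ord1 mul0r scale0r.
- by rewrite linear0 /homog_sum big_ord1 mul0r scale0r.
Qed.

Lemma Dsum_shift_seq mu a X : gammac mu a *: Dsum (mu + 1) (a%:Z - 1) (shift_seq X) =
  homog_sum (fun k r => r%:R / 2 * Dcoef mu k r) a X.
Proof.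
case: a => [|a].
  by rewrite scaler0 /homog_sum big_ord1 mul0r mul0r scale0r.
rewrite (_ : a.+1%:Z - 1 = a) /=; last by lia.
rewrite homog_sum_shift_seq homog_sumZ; apply: eq_homog_sum => k [|r] /= <-; first by rewrite mulr0 !mul0r.
by rewrite mulrAC Dcoef_shift_r [2 * _]mulrC mulfK ?natr_neq0.
Qed.

Lemma Dsum_euler mu a X : a%:R *: Dsum mu a X =
  2 *: L (Dsum (mu + 1) (a%:Z - 2) X)
  + 2 *: (gammac mu a *: Dsum (mu + 1) (a%:Z - 1) (shift_seq X)).
Proof.
rewrite Dsum_lap Dsum_shift_seq !homog_sumZ homog_sumD; apply: eq_homog_sum => k r <-.
by rewrite natrD -muln2 natrM; field.
Qed.

Lemma Dsum_step_mu mu a X : (mu + a%:R) *: Dsum mu a X =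
  L (Dsum (mu + 1) (a%:Z - 2) X)
  + (mu + (uphalf a)%:R) *: Dsum (mu + 1) a X.
Proof.
rewrite Dsum_lap !homog_sumZ homog_sumD; apply: eq_homog_sum => k r <-.
rewrite (_ : uphalf _ = k + uphalf r)%N; last by lia.
by rewrite Dcoef_shift_mu !natrD -muln2 natrM; ring.
Qed.

Lemma Dsum_half mu a X :
  Dsum (mu + 1) (a%:Z - 2) (shift_seq X)
  + gammac (mu - 1 / 2) a *: Dsum mu (a%:Z - 1) X
  = gammac mu a *: Dsum (mu + 1) (a%:Z - 1) X.
Proof.
case: a => [|a]; first by rewrite /= !scaler0 addr0.
rewrite [in X in _ + X = _](_ : a.+1%:Z - 1 = a); last by lia.
rewrite [in X in _ = X](_ : a.+1%:Z - 1 = a); last by lia.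
have -> : Dsum (mu + 1) (a.+1%:Z - 2) (shift_seq X) = homog_sum (fun k r =>
    if r is r'.+1 then Dcoef (mu + 1) k r' else 0) a X.
  case: a => [|a]; first by rewrite /homog_sum big_ord1 scale0r.
  by rewrite (_ : a.+2%:Z - 2 = a) /= ?homog_sum_shift_seq; last by lia.
rewrite /= !homog_sumZ homog_sumD; apply: eq_homog_sum => k [|r] <-; last first.
  by rewrite -addnS; exact: Dcoef_half.
rewrite add0r /gammac addn0 /= odd_double /= !mul1r.
by rewrite /Dcoef addn0 !big_geq.
Qed.

Lemma Dsum_iter_lap l a X (mu := - (l + a)%:R) :
  iter l L (Dsum mu a X) = (Kcoef l a)%:R *: Dsum mu (a + 2 * l)%N X.
Proof.
rewrite /= homog_sumZ homog_sum_iter_lap; apply: eq_homog_sum => k r e; case: ltnP => kl.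
  by rewrite /mu Dcoef_vanish ?mulr0 //; lia.
have ea : ((k - l).*2 + r = a)%N by lia.
by rewrite /mu -ea Dcoef_shift_Kcoef subnK.
Qed.

(** As mu + 1 = - (l + (a - 1)), this is [Dsum_iter_lap] at a - 1.  The constants
    agree because [a/2] = [(a-1)/2] when a is odd, while for a even the factors
    gamma(mu,a) = - (l + a/2) and gamma(mu,a+2l) = - a/2 account for the
    quotient of the two values of K. *)
Lemma Dsum_iter_lap_pred l a X (mu := - (l + a)%:R) :
  iter l L (gammac mu a *: Dsum (mu + 1) (a%:Z - 1) X)
  = (Kcoef l a)%:R *: (gammac mu (a + 2 * l) *:
      Dsum (mu + 1) ((a + 2 * l)%N%:Z - 1) X).
Proof.
rewrite iter_linearZ; case: a @mu => [|a] mu.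
  rewrite /= iter_fix ?linear0 // add0n mul2n /gammac odd_double.
  by rewrite -muln2 natrM mulfK ?natr_neq0 // /mu addn0 addNr scale0r scaler0.
rewrite (_ : a.+1%:Z - 1 = a) ; last by lia.
rewrite (_ : (a.+1 + 2 * l)%N%:Z - 1 = (a + 2 * l)%N); last by lia.
have -> : mu + 1 = - (l + a)%:R by rewrite /mu addnS -nat1r; ring.
rewrite Dsum_iter_lap !scalerA; congr (_ *: _).
rewrite /gammac addSn !oddS oddD mul2n odd_double addbF.
case: ifP => /= ao.
  rewrite mul1r mulr1; congr (_%:R); apply: eq_bigr => k _; congr (_ + _)%N.
  by move: ao; lia.
have ea : (a./2.+1 = a.+1./2)%N by move: ao; lia.
have ea2 : (a.+1 = 2 * a.+1./2)%N by move: ao; lia.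
have -> : mu + a.+1%:R / 2 = - (a./2 + l).+1%:R.
  rewrite /mu {2}ea2 -ea natrM mulrAC divff ?natr_neq0 // mul1r.
  rewrite (_ : l + a.+1 = l + (2 * a./2.+1))%N; last by move: ao; lia.
  by rewrite -!nat1r !natrD natrM -!nat1r; ring.
have -> : mu + (a + l.*2).+1%:R / 2 = - a./2.+1%:R.
  rewrite /mu (_ : (a + l.*2).+1 = 2 * (a./2.+1 + l))%N; last by move: ao; lia.
  rewrite natrM mulrAC divff ?natr_neq0 // mul1r.
  rewrite (_ : l + a.+1 = l + (2 * a./2.+1))%N; last by move: ao; lia.
  by rewrite !natrD natrM -!nat1r; ring.
rewrite mulNr mulrN -!natrM; congr (- _%:R).
apply/eqP; rewrite -(eqn_pmul2r (fact_gt0 a./2)); apply/eqP.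
rewrite -mulnA Kcoef_fact -factS -mulnA -factS ea Kcoef_fact -ea.
by rewrite addSn.
Qed.
(** By [Dsum_step_mu] the argument of Lap^l is ([a/2] + l + 1) D^(mu+1)_a, to which
    [Dsum_iter_lap] applies with l in place of l + 1; the factor [a/2] + l + 1 is
    the last one of K. *)
Lemma Dsum_iter_lap_mixed l a X (mu := - (l.+1 + a)%:R) :
  iter l L (L (Dsum (mu + 1) (a%:Z - 2) X) + l.+1%:R *: Dsum mu a X)
  = (Kcoef l.+1 a)%:R *: Dsum (mu + 1) ((a + 2 * l.+1)%N%:Z - 2) X.
Proof.
have mu1 : mu + 1 = - (l + a)%:R by rewrite /mu addSn -nat1r; ring.
have -> : L (Dsum (mu + 1) (a%:Z - 2) X) + l.+1%:R *: Dsum mu a X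
    = (a./2 + l.+1)%:R *: Dsum (mu + 1) a X.
  have := Dsum_step_mu mu a X.
  have -> : mu + a%:R = - l.+1%:R by rewrite /mu natrD; ring.
  have -> : mu + (uphalf a)%:R = - (a./2 + l.+1)%:R.
    rewrite /mu (_ : l.+1 + a = (a./2 + l.+1) + uphalf a)%N; last by lia.
    by rewrite natrD; ring.
  by rewrite !scaleNr => E; rewrite -[X in _ + X]opprK E opprB addrC subrK.
rewrite iter_linearZ mu1 Dsum_iter_lap scalerA -natrM.
rewrite (_ : (a + 2 * l.+1)%N%:Z - 2 = (a + 2 * l)%N); last by lia.
by congr (_%:R *: _); rewrite /Kcoef [RHS]big_nat_recr //= mulnC.
Qed.
End Sums.

(** * The factorization in an abstract complex *)

Arguments Dsum : simpl never.

Section Complex.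
Variable R : realType.
Notation C := R[i].
Variables (V : lmodType C) (d delta : {linear V -> V}).
Hypotheses (dd : forall v, d (d v) = 0) (deltadelta : forall v, delta (delta v) = 0).

Definition hodge (v : V) : V := - (d (delta v) + delta (d v)).

Fact hodge_is_linear : linear hodge.
Proof.
move=> c u v; by rewrite /hodge !linearP /= addrACA -scalerDr opprD -scalerN.
Qed.
HB.instance Definition _ := GRing.isLinear.Build C V V _ hodge hodge_is_linear.

Lemma d_hodge v : d (hodge v) = hodge (d v).
Proof. by rewrite /hodge linearN linearD /= !dd linear0 add0r addr0. Qed.

Lemma delta_hodge v : delta (hodge v) = hodge (delta v).
Proof. by rewrite /hodge linearN linearD /= !deltadelta linear0 add0r addr0. Qed.

Notation D := (Dsum hodge).

Definition branson_op (p : C) l v :=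
  let v' := iter l.-1 hodge v in
  (p - l%:R) *: d (delta v') + (p + l%:R) *: delta (d v').

(** D^(i -> i-1) in terms of the normal jets A of the form and B of its
    contraction, with the restriction already moved to the right. *)
Definition Dminus_op (mu c : C) (a : nat) (A B : nat -> V) :=
  - d (delta (D (mu + 1) (a%:Z - 2) B))
  - gammac mu a *: (delta (D (mu + 1) (a%:Z - 1) A) - D (mu + 1) (a%:Z - 1) (shift_seq B))
  + c *: D mu a B.

Definition Dplus_op (mu c : C) (a : nat) (A B : nat -> V) :=
  d (delta (D (mu + 1) (a%:Z - 2) A)) - d (D (mu + 1) (a%:Z - 2) (shift_seq B))
  - gammac (mu - 1 / 2) a *: d (D mu (a%:Z - 1) B)
  + c *: D mu a A.

Lemma branson_op_iter (p : C) l v :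
  branson_op p l.+1 v = iter l hodge
    ((p - l.+1%:R) *: d (delta v) + (p + l.+1%:R) *: delta (d v)).
Proof.
rewrite /branson_op /= iter_linearD !iter_linearZ.
by rewrite -!(iter_morph _ _ d_hodge) -!(iter_morph _ _ delta_hodge) -!(iter_morph _ _ d_hodge).
Qed.

(** Eliminate delta d W = - Lap W - d delta W, then insert the hypothesis. *)
Lemma branson_mix_d (p : C) l W z : d (delta W) = (- (p + l%:R) / 2) *: d (delta z) ->
  (p - l%:R) *: d (delta W) + (p + l%:R) *: delta (d W)
  = - (p + l%:R) *: (hodge W - l%:R *: d (delta z)).
Proof.
move=> dW; have -> : (p - l%:R) *: d (delta W) = (p + l%:R) *: d (delta W) - (2 * l%:R) *: d (delta W).
  by rewrite -scalerBl; congr (_ *: _); ring.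
rewrite {2}dW scalerA addrAC -scalerDr -[d _ + _]opprK -/(hodge W) scalerN -scaleNr.
by rewrite scalerBr scalerA -2![- (_ *: d _)]scaleNr; congr (_ + _ *: _); field.
Qed.

Lemma branson_mix_delta (q : C) l W z : delta (d W) = ((q - l%:R) / 2) *: delta (d z) ->
  (q - l%:R) *: d (delta W) + (q + l%:R) *: delta (d W)
  = - (q - l%:R) *: (hodge W - l%:R *: delta (d z)).
Proof.
move=> dW; have -> : (q + l%:R) *: delta (d W) = (q - l%:R) *: delta (d W) + (2 * l%:R) *: delta (d W).
  by rewrite -scalerDl; congr (_ *: _); ring.
rewrite {2}dW scalerA addrA -scalerDr -[d _ + _]opprK -/(hodge W) scalerN -scaleNr.
by rewrite scalerBr scalerA -[- (_ *: delta _)]scaleNr; congr (_ + _ *: _); field.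
Qed.

(** [Dsum_euler] replaces the normal derivative of B, and
    Lap x = - (d delta x + delta d x) cancels the exact term - d delta x. *)
Lemma Dminus_opE (p : C) l a A B (mu := - (l + a)%:R)
    (c := - (p + l%:R + a%:R) / 2) :
  Dminus_op mu c a A B =
  delta (d (D (mu + 1) (a%:Z - 2) B) - gammac mu a *: D (mu + 1) (a%:Z - 1) A)
  + (- (p + l%:R) / 2) *: D mu a B.
Proof.
have := Dsum_euler hodge mu a B; rewrite /Dminus_op.
set x := D _ (_ - 2) B; set t := D _ _ A; set y := D _ _ (shift_seq B); set z := D mu a B.
rewrite -scalerDr => /(congr1 ( *:%R 2^-1)); rewrite !scalerA mulVf ?natr_neq0 // scale1r => e.
have {e} ey : gammac mu a *: y = (2^-1 * a%:R) *: z + (d (delta x) + delta (d x)).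
  by rewrite e addrAC /= /hodge addNr add0r.
rewrite scalerBr opprB ey linearB [delta (_ *: _)]linearZ /=.
have -> : - (p + l%:R) / 2 = c + 2^-1 * a%:R by rewrite /c; field.
rewrite [in RHS]scalerDl !addrA.
by rewrite [LHS](ACl (1*3*4*5*6*2))/= addNr add0r.
Qed.

Lemma extd_codif_Dminus_op (p : C) l a A B (mu := - (l + a)%:R)
    (c := - (p + l%:R + a%:R) / 2) (W := Dminus_op mu c a A B) :
  d (delta W) = (- (p + l%:R) / 2) *: d (delta (D mu a B)).
Proof.
by rewrite /W Dminus_opE linearD deltadelta add0r !linearZ.
Qed.

(** Lap^l maps every sum of order a to K times that of order a + 2l, except for
    the sum at mu + 1 and order a - 2, where [Dsum_iter_lap_mixed] leaves the
    correction l D^mu_a. *)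
Lemma Dminus_op_shift (c : C) l a A B (mu := - (l.+1 + a)%:R) (W := Dminus_op mu c a A B) :
  (Kcoef l.+1 a)%:R *: Dminus_op mu c (a + 2 * l.+1) A B =
  iter l hodge (hodge W - l.+1%:R *: d (delta (D mu a B))).
Proof.
have hd j v : iter j hodge (d v) = d (iter j hodge v) by rewrite (iter_morph _ _ d_hodge).
have hdelta j v : iter j hodge (delta v) = delta (iter j hodge v) by rewrite (iter_morph _ _ delta_hodge).
have E1 := Dsum_iter_lap_mixed hodge l a B.
have E2 := Dsum_iter_lap hodge l.+1 a B.
have EA := Dsum_iter_lap_pred hodge l.+1 a A.
have EB := Dsum_iter_lap_pred hodge l.+1 a (shift_seq B).
rewrite -/mu in E1 E2 EA EB.
rewrite /W /Dminus_op !scalerBr -![gammac _ _ *: delta _]linearZ /=.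
rewrite scalerDr !scalerBr scalerN -![(Kcoef _ _)%:R *: _ _]linearZ /=.
rewrite -![(Kcoef _ _)%:R *: delta _]linearZ /=.
rewrite [_ *: (c *: _)]scalerA [_ * c]mulrC -scalerA -E1 -E2 -EA -EB !iterSr.
rewrite -!hdelta -!hd -iter_linearZ -[- iter _ _ _]iter_linearN -!iter_linearB -iter_linearD.
congr iter; rewrite [hodge (_ + _)]linearD /= [hodge (_ - _)]linearB /= [hodge (_ - _)]linearB /=.
rewrite [hodge (- _)]linearN /= -!d_hodge -!delta_hodge [hodge (c *: _)]linearZ /=.
rewrite [delta (_ + _)]linearD [d (_ + _)]linearD [delta (_ *: _)]linearZ [d (_ *: _)]linearZ /=.
by rewrite opprD [_ - _ *: _ - _]addrAC [LHS]addrAC.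
Qed.

Lemma branson_Dminus (p : C) l a A B (mu := - (l.+1 + a)%:R)
    (c := - (p + l.+1%:R + a%:R) / 2) :
  branson_op p l.+1 (Dminus_op mu c a A B) =
  (- (p + l.+1%:R) * (Kcoef l.+1 a)%:R) *: Dminus_op mu c (a + 2 * l.+1) A B.
Proof.
rewrite -scalerA Dminus_op_shift -iter_linearZ branson_op_iter; congr iter.
by apply: branson_mix_d; apply: extd_codif_Dminus_op.
Qed.

Lemma Dplus_opE mu c a A B :
  Dplus_op mu c a A B =
  d (delta (D (mu + 1) (a%:Z - 2) A) - gammac mu a *: D (mu + 1) (a%:Z - 1) B)
  + c *: D mu a A.
Proof.
rewrite -Dsum_half /Dplus_op [in RHS]linearB [d (_ + _)]linearD /=.
by rewrite [d (_ *: _)]linearZ /= [- (d _ + _)]opprD addrA.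
Qed.

Lemma codif_extd_Dplus_op mu c a A B :
  delta (d (Dplus_op mu c a A B)) = c *: delta (d (D mu a A)).
Proof. by rewrite Dplus_opE linearD dd add0r !linearZ. Qed.

(** The correction of [Dsum_iter_lap_mixed] contributes l d delta z, and the change
    of the constant c contributes l Lap z; together they are - l delta d z. *)
Lemma Dplus_op_shift (c : C) l a A B (mu := - (l.+1 + a)%:R) (W := Dplus_op mu c a A B) :
  (Kcoef l.+1 a)%:R *: Dplus_op mu (c + l.+1%:R) (a + 2 * l.+1) A B =
  iter l hodge (hodge W - l.+1%:R *: delta (d (D mu a A))).
Proof.
have hd j v : iter j hodge (d v) = d (iter j hodge v) by rewrite (iter_morph _ _ d_hodge).
have hdelta j v : iter j hodge (delta v) = delta (iter j hodge v) by rewrite (iter_morph _ _ delta_hodge).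
have E1 := Dsum_iter_lap_mixed hodge l a A.
have E2 := Dsum_iter_lap hodge l.+1 a A.
have EB := Dsum_iter_lap_pred hodge l.+1 a B.
rewrite -/mu in E1 E2 EB.
rewrite /W !Dplus_opE scalerDr -[_ *: d _]linearZ /= scalerBr -[_ *: delta _]linearZ /=.
rewrite [_ *: ((c + _) *: _)]scalerA [_ * (c + _)]mulrC -scalerA -E1 -E2 -EB !iterSr.
rewrite -hdelta -iter_linearB -hd -iter_linearZ -iter_linearD.
congr iter; rewrite [hodge (_ + _)]linearD /= -d_hodge [hodge (_ - _)]linearB /= -delta_hodge.
rewrite [hodge (c *: _)]linearZ /= [delta (_ + _)]linearD [delta (_ *: _)]linearZ /=.
rewrite [_ + _ *: _ - _]addrAC [d (_ + _)]linearD [d (_ *: _)]linearZ /=.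
rewrite scalerDl -[in RHS]addrA -[LHS]addrA; congr (_ + _).
rewrite addrCA; congr (_ + _); rewrite -scalerDr -scalerN; congr (_ *: _).
by rewrite /hodge opprD addrA addrN add0r.
Qed.

Lemma branson_Dplus (q : C) l a A B (mu := - (l.+1 + a)%:R) :
  branson_op q l.+1 (Dplus_op mu ((q - l.+1%:R) / 2) a A B) =
  (- (q - l.+1%:R) * (Kcoef l.+1 a)%:R) *:
    Dplus_op mu ((q + l.+1%:R) / 2) (a + 2 * l.+1) A B.
Proof.
have -> : (q + l.+1%:R) / 2 = (q - l.+1%:R) / 2 + l.+1%:R by field.
rewrite -scalerA Dplus_op_shift -iter_linearZ branson_op_iter; congr iter.
by apply: branson_mix_delta; apply: codif_extd_Dplus_op.
Qed.
End Complex.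

(** * The symmetry breaking operators in terms of normal jets *)

Section Link.
Variables (R : realType) (m : nat).
Notation n := m.+1.
Notation F := (form_space R n).
Notation nv := (normal_vec R m).
Notation L := (@hodge R (form_space R m) (@extd R m) (@codif R m)).
Notation T := (der nv).
Implicit Types (w : F) (mu u : R[i]).

Definition jet w (r : nat) : form_space R m := restr (iter r T w).

(** Restriction turns the tangential Laplacian into the Hodge Laplacian of the
    hyperplane and the normal derivatives into the jet. *)
Lemma Rest_Dop mu b w :
  Rest (Dop mu b w) = Dsum L mu b (jet w) :> cochain R m.
Proof.
case: b => b //.
have iterT j : iter j (form_derive nv) (form_val w) = form_val (iter j T w).
  by elim: j => //= j ->.
have iterL j z : iter j (@laplacian_tan R m) (form_val z) = form_val (iter j (@lap_tan R m) z).
  by elim: j => //= j ->; rewrite -val_lap_tan.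
have restrL j z : restr (iter j (@lap_tan R m) z) = iter j L (restr z).
  by elim: j => //= j <-; rewrite restr_lap_tan.
pose z := \sum_(k < b./2.+1) Dcoef mu k (b - k.*2) *: iter k (@lap_tan R m) (iter (b - k.*2) T w).
have -> : Dop mu b w = form_val z.
  rewrite -[RHS]/(\val z) raddf_sum /= /Dop_nat; apply: eq_bigr => k _.
  rewrite iterT iterL; congr (_ * _ *: _).
  by apply: congr_big => //; congr index_iota; have := ltn_ord k; lia.
transitivity (form_val (restr z)) => //; congr form_val; rewrite linear_sum; apply: eq_bigr => k _.
by rewrite linearZ /= restrL.
Qed.

Lemma jet_extd w r : jet (extd w) r = extd (jet w r).
Proof.
rewrite /jet -restr_extd; congr restr.
by elim: r => //= r ->; rewrite der_extd.
Qed.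

(** The normal summand - i_n D_n of the ambient delta raises the order of the jet
    of the contraction by one. *)
Lemma jet_codif w r : jet (codif w) r = codif (jet w r) - jet (contr nv w) r.+1.
Proof.
have E k : iter k T (codif w) = codif (iter k T w) by elim: k => //= j ->; rewrite der_codif.
have E' k : iter k T (contr nv w) = contr nv (iter k T w) by elim: k => //= j ->; rewrite der_contr.
by rewrite /jet E restr_codif /= E' der_contr.
Qed.

Lemma contr_contr v w : contr v (contr v w) = 0.
Proof.
apply/eqP; move/eqP: (contr_anticomm v v w).
by rewrite -addr_eq0 -mulr2n -scaler_nat scaler_eq0 pnatr_eq0.
Qed.

Lemma jet0 r : jet 0 r = 0.
Proof. by rewrite /jet iter_fix linear0. Qed.

Notation D := (Dsum L).

Lemma Dsum_extd mu b X : extd (D mu b X) = D mu b (fun r => extd (X r)).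
Proof.
rewrite (@Dsum_morph R _ L (@extd R m)) // => v.
by apply: (@d_hodge R _ (@extd R m)) => z; exact: extd_extd.
Qed.

Lemma Dsum_codif mu b X : codif (D mu b X) = D mu b (fun r => codif (X r)).
Proof.
rewrite (@Dsum_morph R _ L (@codif R m)) // => v.
by apply: (@delta_hodge R _ _ (@codif R m)) => z; exact: codif_codif.
Qed.

Lemma Dsum_jet_codif mu b w : D mu b (jet (codif w)) =
  codif (D mu b (jet w)) - D mu b (shift_seq (jet (contr nv w))).
Proof.
rewrite Dsum_codif DsumB; congr (D _ _ _).
by apply/funext => r; exact: jet_codif.
Qed.

Lemma Rest_Dop_codiff mu b w : Rest (Dop mu b (codiff w)) =
  codif (D mu b (jet w)) - D mu b (shift_seq (jet (contr nv w))) :> cochain R m.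
Proof. by rewrite -val_codif Rest_Dop Dsum_jet_codif. Qed.

Lemma Rest_Dop_ext_d mu b w :
  Rest (Dop mu b (ext_d w)) = extd (D mu b (jet w)) :> cochain R m.
Proof.
rewrite -[ext_d w]/(form_val (extd w)) Rest_Dop Dsum_extd.
by congr (form_val (D _ _ _)); apply/funext => r; exact: jet_extd.
Qed.

Lemma Rest_Dop_ext_d_codiff mu b w : Rest (Dop mu b (ext_d (codiff w))) =
  extd (codif (D mu b (jet w)) - D mu b (shift_seq (jet (contr nv w)))) :> cochain R m.
Proof.
by rewrite -val_codif Rest_Dop_ext_d Dsum_jet_codif.
Qed.

Local Opaque extd codif Dsum jet gammac mu_of.

Lemma DminusE i u a w :
  Dminus i u a w =
  Dminus_op (@extd R m) (@codif R m) (mu_of m i u) ((u + 2 * i%:R - n%:R) / 2) a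
    (jet w) (jet (contr nv w)) :> cochain R m.
Proof.
have RestE (w1 w2 w3 : cochain R n) (c1 c2 : R[i]) :
    Rest (- w1 - c1 *: w2 + c2 *: w3) = - Rest w1 - c1 *: Rest w2 + c2 *: Rest w3 by [].
have valE (x y z : form_space R m) (c1 c2 : R[i]) : form_val (- x - c1 *: y + c2 *: z)
    = - form_val x - c1 *: form_val y + c2 *: form_val z by [].
rewrite /Dminus RestE -[contract nv w]/(form_val (contr nv w)).
rewrite (Rest_Dop_ext_d_codiff _ _ (contr nv w)) (Rest_Dop_codiff _ _ w).
rewrite (Rest_Dop _ _ (contr nv w)) -valE; congr form_val; rewrite /Dminus_op.
(* As i_n i_n = 0 this jet vanishes; the form 0 - 0 makes its sum cancel by
   linearity. *)
have -> : shift_seq (jet (contr nv (contr nv w))) = fun _ => 0 - 0.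
  by apply/funext => r; rewrite contr_contr /shift_seq jet0 subr0.
by rewrite -DsumB subrr subr0.
Qed.

Lemma DplusE i u a w :
  Dplus i u a w =
  Dplus_op (@extd R m) (@codif R m) (mu_of m i u) ((u + a%:R) / 2) a
    (jet w) (jet (contr nv w)) :> cochain R m.
Proof.
have RestE (w1 w2 w3 : cochain R n) (c1 c2 : R[i]) :
    Rest (w1 - c1 *: w2 + c2 *: w3) = Rest w1 - c1 *: Rest w2 + c2 *: Rest w3 by [].
rewrite /Dplus RestE -[contract nv w]/(form_val (contr nv w)).
have valE (x y z : form_space R m) (c1 c2 : R[i]) : form_val (x - c1 *: y + c2 *: z)
    = form_val x - c1 *: form_val y + c2 *: form_val z by [].
rewrite /Dplus_op valE (Rest_Dop_ext_d_codiff _ _ w).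
have -> (x y : form_space R m) : extd (codif x - y) = extd (codif x) - extd y by exact: linearB.
by rewrite (Rest_Dop_ext_d _ _ (contr nv w)) (Rest_Dop _ _ w).
Qed.

Lemma bransonE j l (v : form_space R m) :
  branson j l v = branson_op (@extd R m) (@codif R m) (m%:R / 2 - j%:R) l v
    :> cochain R m.
Proof.
have valE (x y : form_space R m) (c1 c2 : R[i]) :
    form_val (c1 *: x + c2 *: y) = c1 *: form_val x + c2 *: form_val y by [].
have valN (x y : form_space R m) : form_val (- (x + y)) = - (form_val x + form_val y) by [].
have cdE (z : form_space R m) : codiff (ext_d z) = form_val (codif (extd z)).
  by rewrite val_codif.
have dcE (z : form_space R m) : ext_d (codiff z) = form_val (extd (codif z)).
  by rewrite -val_codif.
have iterE k : iter k (@hodge_laplacian R m) (form_val v) = form_val (iter k L v).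
  elim: k => [|k IH] //; rewrite !iterS IH /hodge_laplacian cdE dcE.
  by rewrite -valN.
rewrite /branson /branson_op iterE; move: (iter _ _ _) => z.
by rewrite cdE dcE -valE.
Qed.
End Link.

Lemma form_skew_smooth (R : realType) n i (w : cochain R n) :
  is_form i w -> w \in @skew_smooth R n.
Proof.
move=> fw; apply/skew_smoothP; split; first by case: fw.
by move=> x s1 s2 u v; exact: form_swap fw.
Qed.

Theorem theorem1p10 (R : realType) (m : nat) (i a l : nat) :
  let n := m.+1 in
  (2 <= n)%N -> (i <= n)%N -> (0 < l)%N ->
  let u : R[i] := (n%:R - 1) / 2 - i%:R - l%:R - a%:R in
  (i != 0%N ->
     forall w : cochain R n, is_form i w ->
     branson i.-1 l (Dminus i u a w)
     = (- ((n%:R + 1) / 2 - i%:R + l%:R) * (Kcoef l a)%:R : R[i]) *: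
         Dminus i u (a + 2 * l) w)
  /\
  (i != n ->
     forall w : cochain R n, is_form i w ->
     branson i l (Dplus i u a w)
     = (- ((n%:R - 1) / 2 - i%:R - l%:R) * (Kcoef l a)%:R : R[i]) *:
         Dplus i u (a + 2 * l) w).
Proof.
move=> n _ _; case: l => // l _ u.
have mR : m.+1%:R = m%:R + 1 :> R[i] by rewrite natr1.
have muE : mu_of m i u = - (l.+1 + a)%:R.
  by rewrite /mu_of /u /n natrD; ring.
have valZ c (v : form_space R m) : form_val (c *: v) = c *: form_val v by [].
split=> [i0|_] w /form_skew_smooth wF.
  have iE : i.-1%:R = i%:R - 1 :> R[i].
    by rewrite -[in RHS](@prednK i) ?lt0n // -natr1 addrK.
  pose p : R[i] := m%:R / 2 - i.-1%:R.
  have cE : (u + 2 * i%:R - m.+1%:R) / 2 = - (p + l.+1%:R + a%:R) / 2.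
    by rewrite /u /p /n iE mR; field.
  rewrite (DminusE i u a (FormSpace wF)) (DminusE i u (a + _) (FormSpace wF)) bransonE muE cE.
  have -> : (n%:R + 1) / 2 - i%:R + l.+1%:R = p + l.+1%:R.
    by rewrite /p /n iE mR; field.
  by rewrite branson_Dminus ?valZ //; [exact: extd_extd | exact: codif_codif].
pose q : R[i] := m%:R / 2 - i%:R.
have cE : (u + a%:R) / 2 = (q - l.+1%:R) / 2 by rewrite /u /q /n mR; field.
have cE' : (u + (a + 2 * l.+1)%:R) / 2 = (q + l.+1%:R) / 2.
  by rewrite /u /q /n mR natrD natrM; field.
rewrite (DplusE i u a (FormSpace wF)) (DplusE i u (a + _) (FormSpace wF)) bransonE muE cE cE'.
have -> : (n%:R - 1) / 2 - i%:R - l.+1%:R = q - l.+1%:R.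
  by rewrite /q /n mR; field.
by rewrite branson_Dplus ?valZ //; [exact: extd_extd | exact: codif_codif].
Qed.
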